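(* Let $X$ be a connected space homotopy equivalent to a CW-complex, with $H_1(X,\mathbb{Z})$ finitely generated. Let $G=\pi_1(X)$, let $D=(G,G)$ be its derived subgroup, and let $\tilde{D}$ be the subgroup of elements of $G$ whose image in $G/D$ is torsion. Then the group $D/(\tilde{D},G)$ is canonically isomorphic to the cokernel of the map $$\mu: H_2(X,\mathbb{Z})\rightarrow \mathrm{Alt}^2(H^1(X,\mathbb{Z}))\quad\text{given by}\quad \mu(\sigma)(\alpha,\beta)=\sigma\frown(\alpha\wedge\beta).$$
   Context: For subgroups $A,B$ of a group $G$, $(A,B)$ denotes the subgroup generated by the commutators $aba^{-1}b^{-1}$ with $a\in A$, $b\in B$. $\mathrm{Alt}^2(H^1(X,\mathbb{Z}))$ is the group of skew-symmetric integral bilinear forms on $H^1(X,\mathbb{Z})$. For $\alpha,\beta\in H^1(X,\mathbb{Z})$, $\alpha\wedge\beta\in H^2(X,\mathbb{Z})$ denotes their cup product, and $\sigma\frown(\alpha\wedge\beta)\in\mathbb{Z}$ denotes its evaluation on $\sigma\in H_2(X,\mathbb{Z})$ (cap product, with $H_0(X,\mathbb{Z})=\mathbb{Z}$). *)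

(* Defs.v *)
From HB Require Import structures.
From mathcomp Require Import freeg.
From mathcomp Require Import all_boot all_order all_algebra.
From mathcomp Require Import generic_quotient ring_quotient zify ring lra.
From mathcomp Require Import all_classical all_reals.
From mathcomp Require Import topology normedtype continuous_path wedge_sigT.
Import numFieldNormedType.Exports.

Set Implicit Arguments.
Unset Strict Implicit.
Unset Printing Implicit Defensive.

Import Order.TTheory GRing.Theory Num.Theory.
Local Open Scope classical_set_scope.
Local Open Scope ring_scope.
Local Open Scope quotient_scope.

HB.mixin Record isConjClosed (G : groupType) (S : {pred G}) := {
  gpredJr : forall x y : G, x \in S -> (x ^ y)%g \in S
}.

#[short(type="normalClosed")]
HB.structure Definition NormalClosed (G : groupType) :=
  {S of @GroupClosed G S & isConjClosed G S}.

Section GroupQuotient.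
Variables (G : groupType) (N : normalClosed G).
Local Open Scope group_scope.

Definition gequiv (x y : G) := x^-1 * y \in N.

Lemma gequiv_is_equiv : equiv_class_of gequiv.
Proof.
split=> [x|x y|y x z]; rewrite /gequiv.
- by rewrite mulVg gpred1.
- by rewrite -gpredV invgM invgK.
- move=> Nxy Nyz; have := gpredM _ _ Nxy Nyz.
  by rewrite mulgA -(mulgA x^-1) mulgV mulg1.
Qed.

Canonical gequiv_equiv := EquivRelPack gequiv_is_equiv.
Canonical gequiv_encModRel := defaultEncModRel gequiv.

Definition gquot := {eq_quot gequiv}.
HB.instance Definition _ : EqQuotient G gequiv gquot := EqQuotient.on gquot.
HB.instance Definition _ := Choice.on gquot.

Lemma gequivP (x y : G) : reflect (\pi_gquot x = \pi_gquot y) (x^-1 * y \in N).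
Proof. by apply: (iffP idP) => [h|/eqP]; [apply/eqP|]; rewrite piE. Qed.

Definition gq_one : gquot := \pi_gquot (1 : G).
Definition gq_mul (a b : gquot) : gquot := \pi_gquot (repr a * repr b : G).
Definition gq_inv (a : gquot) : gquot := \pi_gquot ((repr a)^-1 : G).

Lemma pi_gq_mul (x y : G) : \pi_gquot (x * y) = gq_mul (\pi x) (\pi y).
Proof.
apply/gequivP; rewrite invgM -mulgA (mulgA x^-1).
set x' := repr _; set y' := repr _.
have hx : x^-1 * x' \in N by apply/gequivP; rewrite reprK.
have hy : y^-1 * y' \in N by apply/gequivP; rewrite reprK.
have := gpredM _ _ (gpredJr _ y hx) hy.
by rewrite conjgE -!mulgA [y * _]mulgA mulgV mul1g.
Qed.

Lemma pi_gq_inv (x : G) : \pi_gquot x^-1 = gq_inv (\pi x).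
Proof.
apply/gequivP; rewrite invgK; set x' := repr _.
have hx : x'^-1 * x \in N by apply/gequivP; rewrite reprK.
by have := gpredJr _ x'^-1 hx; rewrite conjgE invgK !mulgA mulgV mul1g.
Qed.

Lemma gq_mulA : associative gq_mul.
Proof.
move=> a b c; rewrite -[a]reprK -[b]reprK -[c]reprK.
by rewrite -!pi_gq_mul mulgA.
Qed.

Lemma gq_mul1 : left_id gq_one gq_mul.
Proof. by move=> a; rewrite -[a]reprK -pi_gq_mul mul1g. Qed.

Lemma gq_1mul : right_id gq_one gq_mul.
Proof. by move=> a; rewrite -[a]reprK -pi_gq_mul mulg1. Qed.

Lemma gq_mulV : left_inverse gq_one gq_inv gq_mul.
Proof. by move=> a; rewrite -[a]reprK -pi_gq_inv -pi_gq_mul mulVg. Qed.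

Lemma gq_Vmul : right_inverse gq_one gq_inv gq_mul.
Proof. by move=> a; rewrite -[a]reprK -pi_gq_inv -pi_gq_mul mulgV. Qed.

HB.instance Definition _ :=
  isGroup.Build gquot gq_mulA gq_mul1 gq_1mul gq_mulV gq_Vmul.

Lemma pi_gquotM : {morph \pi_gquot : x y / x * y >-> x * y}.
Proof. exact: pi_gq_mul. Qed.

HB.instance Definition _ :=
  isMultiplicative.Build G gquot \pi_gquot pi_gquotM.
HB.instance Definition _ :=
  Multiplicative_isUMagmaMorphism.Build G gquot \pi_gquot erefl.

End GroupQuotient.

Section Generated.
Variable G : groupType.
Local Open Scope group_scope.

Definition generated (S : set G) : {pred G} :=
  fun x => `[< forall H : groupClosed G, (forall s, S s -> s \in H) -> x \in H >].

Lemma generated_ge (S : set G) s : S s -> s \in generated S.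
Proof. by move=> Ss; apply/asboolP => H; exact. Qed.

Lemma generatedM S : mulg_closed (generated S).
Proof.
move=> x y /asboolP hx /asboolP hy; apply/asboolP => H SH.
by rewrite gpredM ?hx ?hy.
Qed.

Lemma generated1 S : 1 \in generated S.
Proof. by apply/asboolP => H _; exact: gpred1. Qed.

Lemma generatedV S : invg_closed (generated S).
Proof. by move=> x /asboolP hx; apply/asboolP => H SH; rewrite gpredV hx. Qed.

HB.instance Definition _ S := isMulClosed.Build G (generated S) (@generatedM S).
HB.instance Definition _ S := isMul1Closed.Build G (generated S) (generated1 S).
HB.instance Definition _ S := isInvClosed.Build G (generated S) (@generatedV S).

Section Conj.
Variables (H : groupClosed G) (y : G).
Definition conj_pred : {pred G} := fun x => x ^ y \in H.
Lemma conj_predM : mulg_closed conj_pred.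
Proof. by move=> a b ha hb; rewrite unfold_in conjMg gpredM. Qed.
Lemma conj_pred1 : 1 \in conj_pred.
Proof. by rewrite unfold_in conj1g gpred1. Qed.
Lemma conj_predV : invg_closed conj_pred.
Proof. by move=> a ha; rewrite unfold_in conjVg gpredV. Qed.
HB.instance Definition _ := isMulClosed.Build G conj_pred conj_predM.
HB.instance Definition _ := isMul1Closed.Build G conj_pred conj_pred1.
HB.instance Definition _ := isInvClosed.Build G conj_pred conj_predV.
End Conj.

Lemma generatedJ (S : set G) : (forall x y, S x -> S (x ^ y)) ->
  forall x y, x \in generated S -> x ^ y \in generated S.
Proof.
move=> SJ x y /asboolP hx; apply/asboolP => H SH.
by have := hx (conj_pred H y); apply => s /(SJ s y)/SH.
Qed.

(* [~ a, b] is a^-1 * b^-1 * a * b in the library; here it is a * b * a^-1 * b^-1. *)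
Definition commutators (A B : set G) : set G :=
  [set x | exists a b, [/\ A a, B b & x = a * b * a^-1 * b^-1]].

Definition commsub (A B : set G) : {pred G} := generated (commutators A B).

HB.instance Definition _ A B := GroupClosed.on (commsub A B).

Lemma commsubJ (A B : set G) :
  (forall x y, A x -> A (x ^ y)) -> (forall x y, B x -> B (x ^ y)) ->
  forall x y, x \in commsub A B -> x ^ y \in commsub A B.
Proof.
move=> AJ BJ; apply: generatedJ => _ y [a [b [Aa Bb ->]]].
exists (a ^ y), (b ^ y); split; [exact: AJ|exact: BJ|].
by rewrite !conjMg !conjVg.
Qed.

Definition derived : {pred G} := commsub setT setT.
HB.instance Definition _ := GroupClosed.on derived.
HB.instance Definition _ := isConjClosed.Build G derived
  (commsubJ (fun _ _ _ => I) (fun _ _ _ => I)).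

Definition Dtilde : set G :=
  [set g | exists n, (0 < n)%N /\ (\pi_(gquot derived) g) ^+ n = 1].

Lemma DtildeJ x y :
  Dtilde x -> Dtilde (x ^ y).
Proof.
move=> [n [n0 xn]]; exists n; split=> //.
by rewrite gmulfJ -conjXg xn conj1g.
Qed.

Definition commDtilde : {pred G} := commsub Dtilde setT.
HB.instance Definition _ := GroupClosed.on commDtilde.
HB.instance Definition _ := isConjClosed.Build G commDtilde
  (commsubJ DtildeJ (fun _ _ _ => I)).

Lemma commDtilde_derived : {subset commDtilde <= derived}.
Proof.
move=> x /asboolP; apply => s [a [b [_ _ ->]]].
by apply: generated_ge; exists a, b.
Qed.

End Generated.

Section SubQuotient.
Variables (G : groupType) (H : groupClosed G) (N : normalClosed G).

Definition subg_of := {x : G | x \in H}.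
HB.instance Definition _ := SubChoice.on subg_of.
Lemma subg_of_closed : group_closed H.
Proof. by split; [exact: gpred1|exact: gpredF]. Qed.
HB.instance Definition _ :=
  SubChoice_isSubGroup.Build G (mem H) subg_of subg_of_closed.

Definition subg_pred : {pred subg_of} := fun x => val x \in N.
Lemma subg_predM : mulg_closed subg_pred.
Proof. by move=> x y hx hy; rewrite unfold_in valM gpredM. Qed.
Lemma subg_pred1 : 1%g \in subg_pred.
Proof. by rewrite unfold_in val1 gpred1. Qed.
Lemma subg_predV : invg_closed subg_pred.
Proof. by move=> x hx; rewrite unfold_in gmulfV gpredV. Qed.
Lemma subg_predJ x y : x \in subg_pred -> (x ^ y)%g \in subg_pred.
Proof. by move=> hx; rewrite unfold_in gmulfJ gpredJr. Qed.
HB.instance Definition _ := isMulClosed.Build subg_of subg_pred subg_predM.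
HB.instance Definition _ := isMul1Closed.Build subg_of subg_pred subg_pred1.
HB.instance Definition _ := isInvClosed.Build subg_of subg_pred subg_predV.
HB.instance Definition _ := isConjClosed.Build subg_of subg_pred subg_predJ.

(* H / (H :&: N), for H a subgroup and N a normal subgroup of G; this is H / N
   when N is contained in H (see commDtilde_derived). *)
Definition subquot := gquot subg_pred.
HB.instance Definition _ := Group.on subquot.
End SubQuotient.
Arguments derived : clear implicits.
Arguments Dtilde : clear implicits.
Arguments commDtilde : clear implicits.

Section UnitInterval.
Variable R : realType.

Definition I01 : Type := set_type (`[0, 1]%classic : set R).
HB.instance Definition _ := Topological.on I01.

Lemma clamp_subproof (t : R) : Num.max 0 (Num.min 1 t) \in (`[0, 1]%classic : set R).
Proof.
rewrite inE /= in_itv /= le_max lexx /= ge_max ler01 /= ge_min lexx //.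
Qed.

(* The retraction of R onto [0, 1], used to write paths by explicit formulas in
   a real parameter. *)
Definition clamp (t : R) : I01 :=
  exist (fun x : R => x \in (`[0, 1]%classic : set R)) _ (clamp_subproof t).

Definition ival (t : I01) : R := set_val t.

Lemma ival_ge0 (t : I01) : 0 <= ival t.
Proof. by have /set_mem := valP t; rewrite /= in_itv /= => /andP[]. Qed.

Lemma ival_le1 (t : I01) : ival t <= 1.
Proof. by have /set_mem := valP t; rewrite /= in_itv /= => /andP[]. Qed.

Lemma ival_inj : injective ival.
Proof. exact: val_inj. Qed.

Lemma clampK (t : R) : 0 <= t <= 1 -> ival (clamp t) = t.
Proof.
move=> /andP[t0 t1]; rewrite /ival /= set_valE /=.
by rewrite (min_idPr t1) (max_idPr t0).
Qed.

Lemma ivalK (t : I01) : clamp (ival t) = t.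
Proof. by apply: ival_inj; rewrite clampK // ival_ge0 ival_le1. Qed.

Lemma clamp_neq : clamp 0 != clamp 1.
Proof.
apply/eqP => /(congr1 ival); rewrite !clampK ?lexx ?ler01 //.
by move/eqP; rewrite eq_sym oner_eq0.
Qed.

HB.instance Definition _ := isBiPointed.Build I01 clamp_neq.

Lemma zeroE : zero = clamp 0 :> I01. Proof. by []. Qed.
Lemma oneE : one = clamp 1 :> I01. Proof. by []. Qed.
Lemma ival0 : ival zero = 0. Proof. by rewrite clampK ?lexx ?ler01. Qed.
Lemma ival1 : ival one = 1. Proof. by rewrite clampK ?lexx ?ler01. Qed.

Lemma ival_continuous : continuous ival.
Proof. exact: initial_continuous. Qed.

Lemma continuous_set_type (T U : topologicalType) (A : set U)
  (f : T -> set_type A) : continuous (set_val \o f) -> continuous f.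
Proof.
move=> cf; apply/continuousP => _ [B oB <-].
by move/continuousP: cf => /(_ B oB); rewrite comp_preimage.
Qed.

Lemma clamp_continuous : continuous clamp.
Proof.
apply: continuous_set_type => x /=.
rewrite /comp set_valE /=.
apply: (@continuous_max R _ (cst 0) (fun t : R => Num.min 1 t)).
  exact: cvg_cst.
apply: (@continuous_min R _ (cst 1) id); first exact: cvg_cst.
exact: cvg_id.
Qed.
End UnitInterval.

Section Gluing.
Variables (R : realType) (T X : topologicalType).

Lemma glue_continuous (s : T -> R) (c : R) (f g : T -> X) :
  continuous s -> continuous f -> continuous g ->
  (forall x, s x = c -> f x = g x) ->
  continuous (fun x => if s x <= c then f x else g x).
Proof.
move=> cs cf cg fg; set h := (h in continuous h).
pose A := s @^-1` [set x | x <= c]; pose B := s @^-1` [set x | c <= x].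
have cA : closed A by apply: preimage_closed => //; exact: closed_le.
have continuousB_fun : closed B by apply: preimage_closed => //; exact: closed_ge.
have AB : A `|` B = setT.
  apply/seteqP; split=> // x _; rewrite /A /B /=.
  by case: (lerP (s x) c) => [|/ltW]; [left|right].
apply/continuous_subspace_setT; rewrite -AB; apply: withinU_continuous => //.
- apply: (@subspace_eq_continuous _ _ _ f); last exact: continuous_subspaceT.
  by move=> x; rewrite inE /A /= => sx; rewrite /from_subspace /h sx.
- apply: (@subspace_eq_continuous _ _ _ g); last exact: continuous_subspaceT.
  move=> x; rewrite inE /B /= => cx; rewrite /from_subspace /h.
  case: lerP => // xc.
  by rewrite fg //; apply/le_anti; rewrite xc cx.
Qed.
End Gluing.

Section FundamentalGroup.
Variables (R : realType) (X : topologicalType).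
Local Notation I := (I01 R).

(* Homotopy relative to the end points; the second coordinate is the time. *)
Definition path_homotopic (x y : X) (p q : {path I from x to y}) : Prop :=
  exists H : I * I -> X, [/\ continuous H,
    forall t, H (t, zero) = p t, forall t, H (t, one) = q t,
    forall s, H (zero, s) = x & forall s, H (one, s) = y].

Lemma continuous_comp_fun (U V W : topologicalType) (f : U -> V) (g : V -> W) :
  continuous f -> continuous g -> continuous (fun x => g (f x)).
Proof. by move=> cf cg x; apply: continuous_comp; [exact: cf|exact: cg]. Qed.

Lemma continuous_pair (U V W : topologicalType) (f : U -> V) (g : U -> W) :
  continuous f -> continuous g -> continuous (fun x => (f x, g x)).
Proof. by move=> cf cg x; apply: cvg_pair; [exact: cf|exact: cg]. Qed.

Lemma continuous_fst (U V : topologicalType) : continuous (fst : U * V -> U).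
Proof. by move=> x; exact: cvg_fst. Qed.

Lemma continuous_snd (U V : topologicalType) : continuous (snd : U * V -> V).
Proof. by move=> x; exact: cvg_snd. Qed.

Lemma continuous_cst_fun (U V : topologicalType) (v : V) : continuous (fun _ : U => v).
Proof. by move=> x; exact: cvg_cst. Qed.

Section RealFun.
Variable U : topologicalType.
Implicit Types f g : U -> R.
Lemma continuousD_fun f g : continuous f -> continuous g -> continuous (fun x => f x + g x).
Proof. by move=> cf cg x; apply: cvgD; [exact: cf|exact: cg]. Qed.
Lemma continuousB_fun f g : continuous f -> continuous g -> continuous (fun x => f x - g x).
Proof. by move=> cf cg x; apply: cvgB; [exact: cf|exact: cg]. Qed.
Lemma continuousM_fun f g : continuous f -> continuous g -> continuous (fun x => f x * g x).
Proof. by move=> cf cg x; apply: cvgM; [exact: cf|exact: cg]. Qed.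
Lemma continuous_min_fun f g :
  continuous f -> continuous g -> continuous (fun x => Num.min (f x) (g x)).
Proof.
by move=> cf cg x; apply: (@continuous_min R U f g); [exact: cf|exact: cg].
Qed.
Lemma continuous_max_fun f g :
  continuous f -> continuous g -> continuous (fun x => Num.max (f x) (g x)).
Proof.
by move=> cf cg x; apply: (@continuous_max R U f g); [exact: cf|exact: cg].
Qed.
Lemma continuous_clamp_fun f : continuous f -> continuous (fun x => clamp (f x)).
Proof. by move=> cf; apply: continuous_comp_fun cf (@clamp_continuous R). Qed.
End RealFun.

Lemma continuous_ival_fun : continuous (@ival R). Proof. exact: ival_continuous. Qed.

Lemma clamp_le0 (t : R) : t <= 0 -> clamp t = zero.
Proof.
move=> t0; apply: ival_inj; rewrite ival0 /ival set_valE /=.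
by rewrite (min_idPr _) ?(le_trans t0) // (max_idPl _).
Qed.

Lemma clamp_ge1 (t : R) : 1 <= t -> clamp t = one.
Proof.
move=> t1; apply: ival_inj; rewrite ival1 /ival set_valE /=.
by rewrite (min_idPl t1) (max_idPr _) ?ler01.
Qed.

Definition concat_fun (f g : I -> X) (t : I) : X :=
  if ival t <= 2^-1 then f (clamp (2 * ival t)) else g (clamp (2 * ival t - 1)).

Lemma concat_continuous (f g : I -> X) : continuous f -> continuous g ->
  f one = g zero -> continuous (concat_fun f g).
Proof.
move=> cf cg fg; apply: glue_continuous; first exact: continuous_ival_fun.
- by apply: continuous_comp_fun _ cf; apply/continuous_clamp_fun/continuousM_fun/continuous_ival_fun; exact: continuous_cst_fun.
- apply: continuous_comp_fun _ cg; apply: continuous_clamp_fun; apply: continuousB_fun; last exact: continuous_cst_fun.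
  by apply/continuousM_fun/continuous_ival_fun; exact: continuous_cst_fun.
- by move=> t ->; rewrite divff ?pnatr_eq0 // subrr -zeroE -oneE.
Qed.

Section Concat.
Variables (x y z : X) (p : {path I from x to y}) (q : {path I from y to z}).
Lemma concat_cts : continuous (concat_fun p q).
Proof.
by apply: concat_continuous; [exact: cts_fun|exact: cts_fun|];
  rewrite path_one path_zero.
Qed.
Lemma concat0 : concat_fun p q zero = x.
Proof.
by rewrite /concat_fun ival0 invr_ge0 ler0n mulr0 -zeroE path_zero.
Qed.
Lemma concat1 : concat_fun p q one = z.
Proof.
rewrite /concat_fun ival1 ifF; last by apply/negbTE; rewrite -ltNge; lra.
by rewrite clamp_ge1 ?path_one //; lra.
Qed.
Definition path_concat : {path I from x to z} := mk_path concat_cts concat0 concat1.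
End Concat.

Section Inverse.
Variables (x y : X) (p : {path I from x to y}).
Definition inv_fun (t : I) : X := p (clamp (1 - ival t)).
Lemma inv_cts : continuous inv_fun.
Proof.
apply: continuous_comp_fun _ (@cts_fun _ _ p).
by apply/continuous_clamp_fun/continuousB_fun; [exact: continuous_cst_fun|exact: continuous_ival_fun].
Qed.
Lemma inv0 : inv_fun zero = y.
Proof. by rewrite /inv_fun ival0 subr0 -oneE path_one. Qed.
Lemma inv1 : inv_fun one = x.
Proof. by rewrite /inv_fun ival1 subrr -zeroE path_zero. Qed.
Definition path_inverse : {path I from y to x} := mk_path inv_cts inv0 inv1.
End Inverse.

Definition path_const (x : X) : {path I from x to x} :=
  mk_path (@continuous_cst_fun I X x) erefl erefl.

Lemma path_homotopic_refl x y (p : {path I from x to y}) : path_homotopic p p.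
Proof.
exists (fun u => p u.1); split=> // [|s|s].
- exact: continuous_comp_fun (@continuous_fst I I) (@cts_fun _ _ p).
- exact: path_zero.
- exact: path_one.
Qed.

Lemma path_homotopic_sym x y (p q : {path I from x to y}) :
  path_homotopic p q -> path_homotopic q p.
Proof.
move=> [H [cH H0 H1 Hx Hy]].
exists (fun u => H (u.1, clamp (1 - ival u.2))); split=> // [|t|t].
- apply: continuous_comp_fun _ cH; apply: continuous_pair; first exact: continuous_fst.
  apply/continuous_clamp_fun/continuousB_fun; first exact: continuous_cst_fun.
  exact: continuous_comp_fun (@continuous_snd I I) continuous_ival_fun.
- by rewrite /= ival0 subr0 -oneE H1.
- by rewrite /= ival1 subrr -zeroE H0.
Qed.

Lemma path_homotopic_trans x y (p q r : {path I from x to y}) :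
  path_homotopic p q -> path_homotopic q r -> path_homotopic p r.
Proof.
move=> [H [cH H0 H1 Hx Hy]] [K [cK K0 K1 Kx Ky]].
exists (fun u => if ival u.2 <= 2^-1 then H (u.1, clamp (2 * ival u.2))
                 else K (u.1, clamp (2 * ival u.2 - 1))).
have c2 : continuous (fun u : I * I => ival u.2).
  exact: continuous_comp_fun (@continuous_snd I I) continuous_ival_fun.
split=> [|t|t|s|s] /=.
- apply: glue_continuous => //.
  + apply: continuous_comp_fun _ cH; apply: continuous_pair; first exact: continuous_fst.
    by apply/continuous_clamp_fun/continuousM_fun => //; exact: continuous_cst_fun.
  + apply: continuous_comp_fun _ cK; apply: continuous_pair; first exact: continuous_fst.
    by apply/continuous_clamp_fun/continuousB_fun; [apply: continuousM_fun => //|]; exact: continuous_cst_fun.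
  + by move=> u ->; rewrite divff ?pnatr_eq0 // subrr -zeroE -oneE H1 K0.
- by rewrite ival0 invr_ge0 ler0n mulr0 -zeroE H0.
- rewrite ival1 ifF; last by apply/negbTE; rewrite -ltNge; lra.
  by rewrite clamp_ge1 ?K1 //; lra.
- by rewrite Hx Kx if_same.
- by rewrite Hy Ky if_same.
Qed.

Lemma path_concat_homotopic x y z (p p' : {path I from x to y})
    (q q' : {path I from y to z}) :
  path_homotopic p p' -> path_homotopic q q' ->
  path_homotopic (path_concat p q) (path_concat p' q').
Proof.
move=> [H [cH H0 H1 Hx Hy]] [K [cK K0 K1 Kx Ky]].
exists (fun u => if ival u.1 <= 2^-1 then H (clamp (2 * ival u.1), u.2)
                 else K (clamp (2 * ival u.1 - 1), u.2)).
have c1 : continuous (fun u : I * I => ival u.1).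
  exact: continuous_comp_fun (@continuous_fst I I) continuous_ival_fun.
split=> [|t|t|s|s] /=.
- apply: glue_continuous => //.
  + apply: continuous_comp_fun _ cH; apply: continuous_pair; last exact: continuous_snd.
    by apply/continuous_clamp_fun/continuousM_fun => //; exact: continuous_cst_fun.
  + apply: continuous_comp_fun _ cK; apply: continuous_pair; last exact: continuous_snd.
    by apply/continuous_clamp_fun/continuousB_fun; [apply: continuousM_fun => //|]; exact: continuous_cst_fun.
  + by move=> u ->; rewrite divff ?pnatr_eq0 // subrr -zeroE -oneE Hy Kx.
- by rewrite H0 K0.
- by rewrite H1 K1.
- by rewrite ival0 invr_ge0 ler0n mulr0 -zeroE Hx.
- rewrite ival1 ifF; last by apply/negbTE; rewrite -ltNge; lra.
  by rewrite clamp_ge1 ?Ky //; lra.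
Qed.

Lemma path_inverse_homotopic x y (p q : {path I from x to y}) :
  path_homotopic p q -> path_homotopic (path_inverse p) (path_inverse q).
Proof.
move=> [H [cH H0 H1 Hx Hy]].
exists (fun u => H (clamp (1 - ival u.1), u.2)); split=> [|t|t|s|s].
- apply: continuous_comp_fun _ cH; apply: continuous_pair; last exact: continuous_snd.
  apply/continuous_clamp_fun/continuousB_fun; first exact: continuous_cst_fun.
  exact: continuous_comp_fun (@continuous_fst I I) continuous_ival_fun.
- by rewrite H0.
- by rewrite H1.
- by rewrite /= ival0 subr0 -oneE Hy.
- by rewrite /= ival1 subrr -zeroE Hx.
Qed.

Lemma reparam_homotopic (x y a b : X) (p : {path I from a to b})
    (f g : I -> R) (u v : {path I from x to y}) :
  continuous f -> continuous g -> f zero = g zero -> f one = g one ->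
  (forall t, u t = p (clamp (f t))) -> (forall t, v t = p (clamp (g t))) ->
  path_homotopic u v.
Proof.
move=> cf cg fg0 fg1 uE vE.
exists (fun w => p (clamp ((1 - ival w.2) * f w.1 + ival w.2 * g w.1))).
have c2 : continuous (fun u : I * I => ival u.2).
  exact: continuous_comp_fun (@continuous_snd I I) continuous_ival_fun.
split=> [|t|t|s|s] /=.
- apply: continuous_comp_fun _ (@cts_fun _ _ p); apply/continuous_clamp_fun/continuousD_fun; apply: continuousM_fun.
  + by apply: continuousB_fun => //; exact: continuous_cst_fun.
  + exact: continuous_comp_fun (@continuous_fst I I) cf.
  + exact: c2.
  + exact: continuous_comp_fun (@continuous_fst I I) cg.
- by rewrite ival0 subr0 mul1r mul0r addr0 uE.
- by rewrite ival1 subrr mul1r mul0r add0r vE.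
- by rewrite fg0 -mulrDl addrNK mul1r -vE path_zero.
- by rewrite fg1 -mulrDl addrNK mul1r -vE path_one.
Qed.

Lemma path_concatA x y z w (p : {path I from x to y})
    (q : {path I from y to z}) (r : {path I from z to w}) :
  path_homotopic (path_concat p (path_concat q r))
                 (path_concat (path_concat p q) r).
Proof.
pose f (t : I) := ival t.
pose g (t : I) : R :=
  Num.min (2 * ival t) (Num.min (ival t + 4^-1) (2^-1 * (ival t + 1))).
apply: (@reparam_homotopic _ _ _ _ (path_concat p (path_concat q r)) f g).
- exact: continuous_ival_fun.
- do 2?apply: continuous_min_fun.
  + by apply/continuousM_fun/continuous_ival_fun; exact: continuous_cst_fun.
  + by apply: continuousD_fun; [exact: continuous_ival_fun|exact: continuous_cst_fun].
  + by apply: continuousM_fun; [|apply: continuousD_fun; [exact: continuous_ival_fun|]]; exact: continuous_cst_fun.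
- rewrite /f /g ival0 (min_idPl _); first by lra.
  by rewrite le_min; apply/andP; split; lra.
- rewrite /f /g ival1 (min_idPr _); first by rewrite (min_idPr _); lra.
  by rewrite ge_min; apply/orP; right; lra.
- by move=> t; rewrite ivalK.
move=> t; rewrite /= /mk_path /concat_fun /g.
have t0 := ival_ge0 t; have t1 := ival_le1 t.
set s := ival t in t0 t1 *.
have [s2|s2] := lerP s 2^-1.
  rewrite clampK; last by apply/andP; split; lra.
  have [s4|s4] := lerP (2 * s) 2^-1.
    rewrite (min_idPl _); last by rewrite le_min; apply/andP; split; lra.
    by rewrite clampK ?s4 //; apply/andP; split; lra.
  rewrite (min_idPr _); last by rewrite ge_min; apply/orP; left; lra.
  rewrite (min_idPl _); last by lra.
  rewrite clampK; last by apply/andP; split; lra.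
  rewrite ifF; last by apply/negbTE; rewrite -ltNge; lra.
  rewrite clampK; last by apply/andP; split; lra.
  rewrite ifT; last by lra.
  by congr (q (clamp _)); lra.
rewrite (min_idPr _); last by rewrite ge_min; apply/orP; right; lra.
rewrite (min_idPr _); last by lra.
rewrite clampK; last by apply/andP; split; lra.
rewrite ifF; last by apply/negbTE; rewrite -ltNge; lra.
rewrite clampK; last by apply/andP; split; lra.
rewrite ifF; last by apply/negbTE; rewrite -ltNge; lra.
by congr (r (clamp _)); lra.
Qed.

Lemma path_concat1 x y (p : {path I from x to y}) :
  path_homotopic (path_concat p (path_const y)) p.
Proof.
apply: (@reparam_homotopic _ _ _ _ p (fun t => Num.min 1 (2 * ival t)) (@ival R)).
- by apply: continuous_min_fun; [exact: continuous_cst_fun|apply/continuousM_fun/continuous_ival_fun; exact: continuous_cst_fun].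
- exact: continuous_ival_fun.
- by rewrite ival0 mulr0 (min_idPr _).
- by rewrite ival1 (min_idPl _) //; lra.
- move=> t; rewrite /= /mk_path /concat_fun.
  have t0 := ival_ge0 t; have t1 := ival_le1 t.
  have [s2|s2] := lerP (ival t) 2^-1; first by rewrite (min_idPr _) //; lra.
  by rewrite (min_idPl _) ?clamp_ge1 ?path_one //; lra.
- by move=> t; rewrite ivalK.
Qed.

Lemma path_1concat x y (p : {path I from x to y}) :
  path_homotopic (path_concat (path_const x) p) p.
Proof.
apply: (@reparam_homotopic _ _ _ _ p
          (fun t => Num.max 0 (2 * ival t - 1)) (@ival R)).
- apply: continuous_max_fun; first exact: continuous_cst_fun.
  by apply: continuousB_fun; [apply/continuousM_fun/continuous_ival_fun|]; exact: continuous_cst_fun.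
- exact: continuous_ival_fun.
- by rewrite ival0 mulr0 (max_idPl _) //; lra.
- by rewrite ival1 (max_idPr _) //; lra.
- move=> t; rewrite /= /mk_path /concat_fun.
  have t0 := ival_ge0 t; have t1 := ival_le1 t.
  have [s2|s2] := lerP (ival t) 2^-1; last by rewrite (max_idPr _) //; lra.
  by rewrite (max_idPl _) ?clamp_le0 ?path_zero //; lra.
- by move=> t; rewrite ivalK.
Qed.

Lemma path_concatV x y (p : {path I from x to y}) :
  path_homotopic (path_concat p (path_inverse p)) (path_const x).
Proof.
apply: (@reparam_homotopic _ _ _ _ p
  (fun t => Num.min (2 * ival t) (2 - 2 * ival t)) (fun=> 0)).
- apply: continuous_min_fun; first by apply/continuousM_fun/continuous_ival_fun; exact: continuous_cst_fun.
  by apply: continuousB_fun; [|apply/continuousM_fun/continuous_ival_fun]; exact: continuous_cst_fun.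
- exact: continuous_cst_fun.
- by rewrite ival0 mulr0 subr0 (min_idPl _).
- by rewrite ival1 mulr1 subrr (min_idPr _).
- move=> t; rewrite /= /mk_path /concat_fun.
  have t0 := ival_ge0 t; have t1 := ival_le1 t.
  have [s2|s2] := lerP (ival t) 2^-1; first by rewrite (min_idPl _) //; lra.
  rewrite (min_idPr _) /inv_fun; last by lra.
  rewrite clampK; last by apply/andP; split; lra.
  by congr (p (clamp _)); lra.
- by move=> t; rewrite -zeroE path_zero.
Qed.

Lemma path_Vconcat x y (p : {path I from x to y}) :
  path_homotopic (path_concat (path_inverse p) p) (path_const y).
Proof.
apply: (@reparam_homotopic _ _ _ _ p
  (fun t => Num.max (1 - 2 * ival t) (2 * ival t - 1)) (fun=> 1)).
- apply: continuous_max_fun; apply: continuousB_fun; do ?exact: continuous_cst_fun; by apply/continuousM_fun/continuous_ival_fun; exact: continuous_cst_fun.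
- exact: continuous_cst_fun.
- by rewrite ival0 mulr0 subr0 (max_idPl _) //; lra.
- by rewrite ival1 (max_idPr _); lra.
- move=> t; rewrite /= /mk_path /concat_fun.
  have t0 := ival_ge0 t; have t1 := ival_le1 t.
  have [s2|s2] := lerP (ival t) 2^-1; last by rewrite (max_idPr _) //; lra.
  rewrite (max_idPl _) /inv_fun; last by lra.
  by rewrite clampK //; apply/andP; split; lra.
- by move=> t; rewrite -oneE path_one.
Qed.

Variable x0 : X.

Definition loop := {path I from x0 to x0}.
HB.instance Definition _ := Choice.on loop.

Definition loop_equiv (p q : loop) : bool := `[< path_homotopic p q >].

Lemma loop_equiv_is_equiv : equiv_class_of loop_equiv.
Proof.
split=> [p|p q|q p r]; rewrite /loop_equiv.
- by apply/asboolP; exact: path_homotopic_refl.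
- by apply/asboolP/asboolP; exact: path_homotopic_sym.
- by move=> /asboolP pq /asboolP qr; apply/asboolP; exact: path_homotopic_trans qr.
Qed.

Canonical loop_equiv_equiv := EquivRelPack loop_equiv_is_equiv.
Canonical loop_equiv_encModRel := defaultEncModRel loop_equiv.

(* The product of the classes of p and q is the class of p followed by q. *)
Definition pi1 := {eq_quot loop_equiv}.
HB.instance Definition _ : EqQuotient loop loop_equiv pi1 := EqQuotient.on pi1.
HB.instance Definition _ := Choice.on pi1.

Lemma pi1P (p q : loop) :
  reflect (\pi_pi1 p = \pi_pi1 q) `[< path_homotopic p q >].
Proof. by apply: (iffP idP) => [h|/eqP]; [apply/eqP|]; rewrite piE. Qed.

Definition pi1_one : pi1 := \pi_pi1 (path_const x0 : loop).
Definition pi1_mul (a b : pi1) : pi1 := \pi_pi1 (path_concat (repr a) (repr b) : loop).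
Definition pi1_inv (a : pi1) : pi1 := \pi_pi1 (path_inverse (repr a) : loop).

Lemma repr_homotopic (p : loop) : path_homotopic (repr (\pi_pi1 p)) p.
Proof. by apply/asboolP/pi1P; rewrite reprK. Qed.

Lemma pi1_mulE (p q : loop) :
  pi1_mul (\pi_pi1 p) (\pi_pi1 q) = \pi_pi1 (path_concat p q : loop).
Proof.
by apply/pi1P/asboolP; apply: path_concat_homotopic; exact: repr_homotopic.
Qed.

Lemma pi1_invE (p : loop) : pi1_inv (\pi_pi1 p) = \pi_pi1 (path_inverse p : loop).
Proof.
by apply/pi1P/asboolP; apply: path_inverse_homotopic; exact: repr_homotopic.
Qed.

Lemma pi1_mulA : associative pi1_mul.
Proof.
elim/quotW=> p; elim/quotW=> q; elim/quotW=> r.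
rewrite (pi1_mulE q r) (pi1_mulE p q) !pi1_mulE.
by apply/pi1P/asboolP; exact: path_concatA.
Qed.

Lemma pi1_mul1 : left_id pi1_one pi1_mul.
Proof.
elim/quotW=> p; rewrite pi1_mulE.
by apply/pi1P/asboolP; exact: path_1concat.
Qed.

Lemma pi1_1mul : right_id pi1_one pi1_mul.
Proof.
elim/quotW=> p; rewrite pi1_mulE.
by apply/pi1P/asboolP; exact: path_concat1.
Qed.

Lemma pi1_mulV : left_inverse pi1_one pi1_inv pi1_mul.
Proof.
elim/quotW=> p; rewrite pi1_invE pi1_mulE.
by apply/pi1P/asboolP; exact: path_Vconcat.
Qed.

Lemma pi1_Vmul : right_inverse pi1_one pi1_inv pi1_mul.
Proof.
elim/quotW=> p; rewrite pi1_invE pi1_mulE.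
by apply/pi1P/asboolP; exact: path_concatV.
Qed.

HB.instance Definition _ :=
  isGroup.Build pi1 pi1_mulA pi1_mul1 pi1_1mul pi1_mulV pi1_Vmul.

End FundamentalGroup.

Section Simplex.
Variable R : realType.

Definition stdsimplex n : set 'rV[R]_n.+1 :=
  [set t | (forall i, 0 <= t 0 i) /\ \sum_i t 0 i = 1].
Arguments stdsimplex : clear implicits.

Definition Delta n : Type := set_type (stdsimplex n).
HB.instance Definition _ n := Topological.on (Delta n).

(* The affine map Delta^m -> Delta^n extending a map f on vertices, in barycentric
   coordinates. *)
Definition push_row m n (f : 'I_m.+1 -> 'I_n.+1) (t : 'rV[R]_m.+1) : 'rV[R]_n.+1 :=
  \row_j \sum_(i | f i == j) t 0 i.

Lemma push_rowP m n (f : 'I_m.+1 -> 'I_n.+1) (t : Delta m) :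
  push_row f (set_val t) \in stdsimplex n.
Proof.
have /set_mem [t0 t1] := valP t; rewrite inE /stdsimplex /=; split.
  by move=> j; rewrite mxE; apply: sumr_ge0 => i _; exact: t0.
rewrite -[RHS]t1 [RHS](partition_big f predT) //=.
by apply: eq_bigr => j _; rewrite mxE.
Qed.

Definition push m n (f : 'I_m.+1 -> 'I_n.+1) (t : Delta m) : Delta n :=
  exist (fun v => v \in stdsimplex n) _ (push_rowP f t).

Lemma pushE m n (f : 'I_m.+1 -> 'I_n.+1) (t : Delta m) j :
  set_val (push f t) 0 j = \sum_(i | f i == j) set_val t 0 i.
Proof. by rewrite mxE. Qed.

Lemma continuous_mx (T : topologicalType) m n (F : T -> 'M[R]_(m, n)) :
  (forall i j, continuous (fun x => F x i j)) -> continuous F.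
Proof.
move=> cF x A [P nP PA]; rewrite /nbhs /=.
have : nbhs x [set y | forall i j, P i j (F y i j)].
  apply: filter_forall => i; apply: filter_forall => j.
  exact: (cF i j x _ (nP i j)).
by apply: filterS => y Py; exact: PA.
Qed.


Lemma push_continuous m n (f : 'I_m.+1 -> 'I_n.+1) : continuous (push f).
Proof.
apply: continuous_set_type; apply: continuous_mx => i j.
have -> : (fun x : Delta m => (set_val \o push f) x i j) =
          (fun x => \sum_(k | f k == j) set_val x 0 k).
  by apply/funext => x; rewrite /= ord1 pushE.
apply: (@continuous_big R 'I_m.+1 +%R 0 (fun k => f k == j) _ (Delta m) _
          (fun k x => set_val x 0 k)).
  exact: add_continuous.
move=> k _; apply: (@continuous_comp_fun (Delta m) 'rV[R]_m.+1 R set_val (fun v => v 0 k)).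
  exact: initial_continuous.
exact: coord_continuous.
Qed.

Lemma push_comp l m n (f : 'I_l.+1 -> 'I_m.+1) (g : 'I_m.+1 -> 'I_n.+1) t :
  push g (push f t) = push (g \o f) t.
Proof.
apply: val_inj; apply/rowP => j; rewrite !pushE.
rewrite [RHS](partition_big f (fun i => g i == j)) //=.
apply: eq_bigr => i /eqP gi; rewrite pushE; apply: eq_bigl => k /=.
by case: (f k =P i) => [->|]; rewrite ?gi ?eqxx ?andbF.
Qed.

(* The i-th barycentric coordinate, meant for i <= n. *)
Definition bary n (t : Delta n) (i : nat) : R := set_val t 0 (inord i).

Lemma bary_continuous n i : continuous (fun t : Delta n => bary t i).
Proof.
apply: (@continuous_comp_fun (Delta n) 'rV[R]_n.+1 R set_val (fun v => v 0 (inord i))).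
  exact: initial_continuous.
exact: coord_continuous.
Qed.

End Simplex.
Arguments stdsimplex : clear implicits.
Arguments Delta : clear implicits.

Section Singular.
Variables (R : realType) (X : topologicalType).

Definition sing n : Type := continuousType (Delta R n) X.
HB.instance Definition _ n := Choice.on (sing n).

Definition sfun n (s : sing n) : Delta R n -> X := s.

Lemma sing_eqP n (s s' : sing n) : sfun s =1 sfun s' -> s = s'.
Proof. by move=> h; apply/continuousEP. Qed.

Lemma smap_subproof m n (f : 'I_m.+1 -> 'I_n.+1) (s : sing n) :
  continuous (sfun s \o push f).
Proof. by apply: continuous_comp_fun (@push_continuous R m n f) _; exact: cts_fun. Qed.

Definition smap m n (f : 'I_m.+1 -> 'I_n.+1) (s : sing n) : sing m :=
  mkcts (@smap_subproof m n f s).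

Lemma smapE m n (f : 'I_m.+1 -> 'I_n.+1) (s : sing n) t :
  sfun (smap f s) t = sfun s (push f t).
Proof. by []. Qed.

Lemma smap_comp l m n (f : 'I_l.+1 -> 'I_m.+1) (g : 'I_m.+1 -> 'I_n.+1) s :
  smap f (smap g s) = smap (g \o f) s.
Proof. by apply: sing_eqP => t; rewrite !smapE push_comp. Qed.

Definition face n (i : 'I_n.+2) (s : sing n.+1) : sing n := smap (lift i) s.

Definition chain n : Type := {freeg (sing n) / int}.
HB.instance Definition _ n := GRing.Lmodule.on (chain n).

Definition bnd n (c : chain n.+1) : chain n :=
  fglift (fun s => \sum_(i < n.+2) (-1) ^+ i *: (<< face i s >> : chain n)) c.

(* C^n(X, Z) = Hom(C_n(X), Z), given by its values on singular simplices; the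
   coboundary is the transpose of bnd, without sign (see ev_bnd). *)
Definition cochain n : Type := sing n -> int.
HB.instance Definition _ n := GRing.Zmodule.on (cochain n).

Definition cobd n (phi : cochain n) : cochain n.+1 :=
  fun s => \sum_(i < n.+2) (-1) ^+ i * phi (face i s).

Definition ev n (phi : cochain n) (c : chain n) : int :=
  fglift (phi : sing n -> int^o) c.

Lemma bnd_zmod n : zmod_morphism (@bnd n).
Proof. exact (@lift_is_additive int (sing n.+1) (chain n) _). Qed.
HB.instance Definition _ n :=
  GRing.isZmodMorphism.Build (chain n.+1) (chain n) (@bnd n) (@bnd_zmod n).

Lemma ev_zmod n phi : zmod_morphism (@ev n phi).
Proof. exact (@lift_is_additive int (sing n) int^o _). Qed.
HB.instance Definition _ n phi :=
  GRing.isZmodMorphism.Build (chain n) int (@ev n phi) (ev_zmod phi).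

Lemma evE n phi (c : chain n) :
  ev phi c = \sum_(s <- dom c) coeff s c * phi s.
Proof.
rewrite -[in LHS](freeg_sumE c) raddf_sum /=; apply: eq_bigr => s _.
by rewrite /ev liftU.
Qed.

Lemma bndE n (c : chain n.+1) : bnd c =
  \sum_(s <- dom c) coeff s c *: \sum_(i < n.+2) (-1) ^+ i *: (<< face i s >> : chain n).
Proof.
rewrite -[in LHS](freeg_sumE c) raddf_sum /=; apply: eq_bigr => s _.
by rewrite /bnd liftU.
Qed.

Lemma ev_gen n (phi : cochain n) s : ev phi << s >> = phi s.
Proof. by rewrite /ev liftU /GRing.scale /= mul1r. Qed.

Lemma evZ n (phi : cochain n) k (c : chain n) : ev phi (k *: c) = k * ev phi c.
Proof. by rewrite -[k]intz !scaler_int raddfMz /= -mulrzl intz. Qed.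

Lemma bnd_gen n s :
  bnd (<< s >> : chain n.+1) =
  \sum_(i < n.+2) (-1) ^+ i *: (<< face i s >> : chain n).
Proof. by rewrite /bnd liftU scale1r. Qed.

Lemma ev_bnd n (phi : cochain n) c : ev phi (bnd c) = ev (cobd phi) c.
Proof.
rewrite bndE [RHS]evE raddf_sum /=; apply: eq_bigr => s _.
rewrite evZ raddf_sum /=; congr (_ * _); apply: eq_bigr => i _.
by rewrite evZ ev_gen.
Qed.

Lemma evDl n (phi psi : cochain n) c : ev (phi + psi) c = ev phi c + ev psi c.
Proof. by rewrite !evE -big_split /=; apply: eq_bigr => s _; exact: mulrDr. Qed.

Lemma evNl n (phi : cochain n) c : ev (- phi) c = - ev phi c.
Proof. by rewrite !evE -sumrN /=; apply: eq_bigr => s _; exact: mulrN. Qed.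

Lemma cobd_zmod n : zmod_morphism (@cobd n).
Proof.
move=> phi psi; apply/funext => s; rewrite /cobd.
rewrite [RHS]/GRing.add /= [X in _ + X]/GRing.opp /= -sumrB.
by apply: eq_bigr => i _; rewrite -mulrBr.
Qed.
HB.instance Definition _ n := GRing.isZmodMorphism.Build
  (cochain n) (cochain n.+1) (@cobd n) (@cobd_zmod n).

End Singular.

Section Homology.
Variables (R : realType) (X : topologicalType).
Local Notation sing := (sing R X).
Local Notation chain := (chain R X).
Local Notation cochain := (cochain R X).

Definition is_cycle n : chain n -> Prop :=
  match n with 0 => fun=> True | m.+1 => fun c => bnd c = 0 end.

Definition cycles n : {pred chain n} := fun c => `[< is_cycle c >].

Lemma cycles_closed n : zmod_closed (@cycles n).
Proof.
case: n => [|n]; first by split=> [|c d _ _]; apply/asboolP.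
split=> [|c d /asboolP hc /asboolP hd]; apply/asboolP; first exact: raddf0.
by move: hc hd => /= hc hd; rewrite raddfB /= hc hd subrr.
Qed.
HB.instance Definition _ n :=
  GRing.isZmodClosed.Build (chain n) (@cycles n) (@cycles_closed n).

Definition cycle n := {c : chain n | c \in @cycles n}.
HB.instance Definition _ n := SubChoice.on (cycle n).
HB.instance Definition _ n :=
  GRing.SubChoice_isSubZmodule.Build (chain n) (@cycles n) (cycle n)
    (@cycles_closed n).

Definition boundaries n : {pred cycle n} :=
  fun z => `[< exists c : chain n.+1, bnd c = val z >].

Lemma boundaries_closed n : zmod_closed (@boundaries n).
Proof.
split=> [|z w /asboolP [c hc] /asboolP [d hd]]; apply/asboolP.
  by exists 0; rewrite !raddf0.
by exists (c - d); rewrite !raddfB /= hc hd.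
Qed.
HB.instance Definition _ n :=
  GRing.isZmodClosed.Build (cycle n) (@boundaries n) (@boundaries_closed n).

Definition homology n : Type := Quotient.quot (@boundaries n).
HB.instance Definition _ n := GRing.Zmodule.on (homology n).
Definition hclass n (z : cycle n) : homology n := \pi_(Quotient.quot (@boundaries n)) z.
Definition hrep n (h : homology n) : chain n :=
  val (repr (h : Quotient.quot (@boundaries n))).

Definition cocycles n : {pred cochain n} := fun phi => cobd phi == 0.

Lemma cocycles_closed n : zmod_closed (@cocycles n).
Proof.
split=> [|phi psi /eqP hphi /eqP hpsi]; rewrite unfold_in ?raddf0 //.
by rewrite raddfB /= hphi hpsi subrr.
Qed.
HB.instance Definition _ n :=
  GRing.isZmodClosed.Build (cochain n) (@cocycles n) (@cocycles_closed n).

Definition cocycle n := {phi : cochain n | phi \in @cocycles n}.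
HB.instance Definition _ n := SubChoice.on (cocycle n).
HB.instance Definition _ n :=
  GRing.SubChoice_isSubZmodule.Build (cochain n) (@cocycles n) (cocycle n)
    (@cocycles_closed n).

Definition is_coboundary n : cochain n -> Prop :=
  match n with
  | 0 => fun phi => phi = 0
  | m.+1 => fun phi => exists psi : cochain m, cobd psi = phi
  end.

Definition coboundaries n : {pred cocycle n} :=
  fun phi => `[< is_coboundary (val phi) >].

Lemma coboundaries_closed n : zmod_closed (@coboundaries n).
Proof.
split=> [|z w /asboolP hz /asboolP hw]; apply/asboolP; rewrite ?raddf0 ?raddfB /=.
  by case: n => [|n] //=; exists 0; rewrite raddf0.
case: n z w hz hw => [|n] z w /= hz hw; first by rewrite hz hw subrr.
by case: hz hw => c hc [d hd]; exists (c - d); rewrite !raddfB /= hc hd.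
Qed.
HB.instance Definition _ n := GRing.isZmodClosed.Build
  (cocycle n) (@coboundaries n) (@coboundaries_closed n).

Definition cohomology n : Type := Quotient.quot (@coboundaries n).
HB.instance Definition _ n := GRing.Zmodule.on (cohomology n).
Definition cclass n (z : cocycle n) : cohomology n :=
  \pi_(Quotient.quot (@coboundaries n)) z.
Definition crep n (a : cohomology n) : cochain n :=
  val (repr (a : Quotient.quot (@coboundaries n))).

Lemma crepP n (a : cohomology n) : cobd (crep a) = 0.
Proof. by have /eqP := valP (repr (a : Quotient.quot (@coboundaries n))). Qed.

Lemma hrepP n (h : homology n.+1) : bnd (hrep h) = 0.
Proof. by have /asboolP := valP (repr (h : Quotient.quot (@boundaries n.+1))). Qed.

Lemma hrep_class n (z : cycle n) :
  exists c : chain n.+1, hrep (hclass z) = val z + bnd c.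
Proof.
have : repr (hclass z : Quotient.quot (@boundaries n)) - z \in @boundaries n.
  by rewrite Quotient.idealrBE reprK.
by move=> /asboolP[c hc]; exists c; rewrite hc raddfB /= addrC subrK.
Qed.

Lemma crep_class n (z : cocycle n) :
  exists2 phi, crep (cclass z) = val z + phi & is_coboundary phi.
Proof.
have : repr (cclass z : Quotient.quot (@coboundaries n)) - z \in @coboundaries n.
  by rewrite Quotient.idealrBE reprK.
by move=> /asboolP h; exists (crep (cclass z) - val z); rewrite // addrC subrK.
Qed.

Lemma hrepD n (h k : homology n) :
  exists c : chain n.+1, hrep (h + k) = hrep h + hrep k + bnd c.
Proof.
pose z := repr (h : Quotient.quot (@boundaries n)).
pose w := repr (k : Quotient.quot (@boundaries n)).
have [c hc] := hrep_class (z + w); exists c.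
by rewrite -hc /hclass raddfD /= !reprK.
Qed.

Lemma crepD n (a b : cohomology n) :
  exists2 phi, crep (a + b) = crep a + crep b + phi & is_coboundary phi.
Proof.
pose z := repr (a : Quotient.quot (@coboundaries n)).
pose w := repr (b : Quotient.quot (@coboundaries n)).
have [phi hphi cphi] := crep_class (z + w); exists phi => //.
by rewrite -hphi /cclass raddfD /= !reprK.
Qed.

(* Evaluation of cohomology classes on homology classes, which does not depend on
   the representatives (see kron_classes). *)
Definition kron n (h : homology n) (a : cohomology n) : int :=
  ev (crep a) (hrep h).

Lemma ev_bnd0 n (phi : cochain n) c : cobd phi = 0 -> ev phi (bnd c) = 0.
Proof. by move=> h; rewrite ev_bnd h evE big1 // => s _; exact: mulr0. Qed.

Lemma ev_cobd0 n (phi : cochain n) (h : homology n) :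
  is_coboundary phi -> ev phi (hrep h) = 0.
Proof.
case: n phi h => [|n] phi h /=.
  by move=> ->; rewrite evE big1 // => s _; exact: mulr0.
by move=> [psi <-]; rewrite -ev_bnd hrepP raddf0.
Qed.

Lemma kronDl n (h k : homology n) a : kron (h + k) a = kron h a + kron k a.
Proof.
have [c hc] := hrepD h k.
by rewrite /kron hc !raddfD /= ev_bnd0 ?addr0 //; exact: crepP.
Qed.

Lemma kronDr n (h : homology n) a b : kron h (a + b) = kron h a + kron h b.
Proof.
have [phi hc cphi] := crepD a b.
by rewrite /kron hc !evDl (ev_cobd0 h cphi) addr0.
Qed.

Lemma kron_class n (h : homology n) (z : cocycle n) :
  kron h (cclass z) = ev (val z) (hrep h).
Proof.
have [phi hc cphi] := crep_class z.
by rewrite /kron hc !evDl (ev_cobd0 h cphi) addr0.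
Qed.

Lemma kron_classes n (z : cycle n) (w : cocycle n) :
  kron (hclass z) (cclass w) = ev (val w) (val z).
Proof.
have [c hc] := hrep_class z.
rewrite kron_class hc raddfD /= ev_bnd0 ?addr0 //.
by have /eqP := valP w.
Qed.

(* Restrictions to the first p + 1 and the last q + 1 vertices, meant for p <= n
   and q <= n (inord truncates otherwise). *)
Definition front p n (s : sing n) : sing p := smap (fun i : 'I_p.+1 => inord i) s.
Definition back q n (s : sing n) : sing q :=
  smap (fun j : 'I_q.+1 => inord (n - q + j)) s.

Definition cupc p q (phi : cochain p) (psi : cochain q) : cochain (p + q) :=
  fun s => phi (front p s) * psi (back q s).

(* Restriction along a vertex map given on nat, meant for f i <= n when i <= m. *)
Definition ssub m n (f : nat -> nat) (s : sing n) : sing m :=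
  smap (fun i : 'I_m.+1 => inord (f i)) s.

Lemma ssub_eq m n (f g : nat -> nat) (s : sing n) :
  (forall i, (i <= m)%N -> f i = g i) -> ssub m f s = ssub m g s.
Proof.
move=> fg; rewrite /ssub; congr smap; apply/funext => i.
by rewrite fg // -ltnS.
Qed.

Lemma ssub_comp l m n (f g : nat -> nat) (s : sing n) :
  (forall i, (i <= l)%N -> (f i <= m)%N) ->
  ssub l f (ssub m g s) = ssub l (g \o f) s.
Proof.
move=> fm; rewrite /ssub smap_comp; congr smap; apply/funext => i /=.
by rewrite inordK // ltnS fm // -ltnS.
Qed.

Lemma faceE n (i : 'I_n.+2) (s : sing n.+1) : face i s = ssub n (bump i) s.
Proof.
rewrite /face /ssub; congr smap; apply/funext => j; apply: val_inj.
by rewrite /= inordK // /bump; have := ltn_ord j; lia.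
Qed.

Lemma cobdE n (phi : cochain n) s :
  cobd phi s = \sum_(0 <= i < n.+2) (-1) ^+ i * phi (ssub n (bump i) s).
Proof. by rewrite big_mkord; apply: eq_bigr => i _; rewrite faceE. Qed.

Lemma leibniz p q (phi : cochain p) (psi : cochain q) (s : sing (p + q).+1) :
  cobd (cupc phi psi) s =
    cobd phi (front p.+1 s) * psi (back q s) +
    (-1) ^+ p * (phi (front p s) * cobd psi (back q.+1 s)).
Proof.
pose a k := phi (ssub p (bump k) s).
pose b k := psi (ssub q (fun j => bump k (p + j)) s).
pose A := phi (front p s); pose B := psi (back q s).
have -> : cobd (cupc phi psi) s =
    \sum_(0 <= k < p.+1 + q.+1) (-1) ^+ k * (a k * b k).
  rewrite cobdE addSn addnS; apply: eq_bigr => k _; congr (_ * (phi _ * psi _)).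
    rewrite /front -/(ssub p id _) ssub_comp // => i ip.
    exact: leq_trans ip (leq_addr _ _).
  rewrite /back -/(ssub q (fun j => p + q - q + j)%N _) ssub_comp.
    by apply: ssub_eq => j _ /=; rewrite addnK.
  by move=> j jq; rewrite addnK leq_add2l.
have aE k : (k <= p)%N -> a k = phi (ssub p (bump k) (front p.+1 s)).
  move=> kp; congr phi; rewrite /front -/(ssub p.+1 id _) ssub_comp //.
  by move=> i ip; rewrite /bump; lia.
have bB k : (k <= p)%N -> b k = B.
  move=> kp; congr psi; rewrite /back -/(ssub q (fun j => (p + q).+1 - q + j)%N s).
  by apply: ssub_eq => j _; rewrite /bump; lia.
have aA k : (p < k)%N -> a k = A.
  move=> kp; congr phi; rewrite /front -/(ssub p id s).
  by apply: ssub_eq => j jp; rewrite /bump /=; lia.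
rewrite (big_cat_nat (n := p.+1)) //=; last by rewrite leq_addr.
rewrite !cobdE.
rewrite [X in _ = X * _ + _]big_nat_recr //=.
rewrite [X in _ = _ + _ * (_ * X)]big_nat_recl //=.
have -> : phi (ssub p (bump p.+1) (front p.+1 s)) = A.
  congr phi; rewrite /front -/(ssub p id s) -/(ssub p.+1 id s) ssub_comp.
    by apply: ssub_eq => j jp; rewrite /bump /=; lia.
  by move=> j jp; rewrite /bump; lia.
have -> : psi (ssub q (bump 0) (back q.+1 s)) = B.
  congr psi; rewrite /back -/(ssub q (fun j => (p + q).+1 - q + j)%N s).
  rewrite -/(ssub q.+1 (fun j => (p + q).+1 - q.+1 + j)%N s) ssub_comp.
    by apply: ssub_eq => j jp; rewrite /bump /=; lia.
  by move=> j jp; rewrite /bump; lia.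
rewrite -/A -/B.
have -> : \sum_(0 <= k < p.+1) (-1) ^+ k * (a k * b k) =
   (\sum_(0 <= k < p.+1) (-1) ^+ k * phi (ssub p (bump k) (front p.+1 s))) * B.
  rewrite mulr_suml; apply: eq_big_nat => k /andP[_ kp].
  by rewrite bB // aE // mulrA.
have -> : \sum_(p.+1 <= k < p.+1 + q.+1) (-1) ^+ k * (a k * b k) =
   (-1) ^+ p * (A * \sum_(0 <= k < q.+1) (-1) ^+ k.+1 *
      psi (ssub q (bump k.+1) (back q.+1 s))).
  rewrite -[X in \sum_(X <= _ < _) _]add0n big_addn addKn.
  rewrite !mulr_sumr; apply: eq_big_nat => k /andP[_ kq].
  rewrite aA; last by lia.
  have -> : b (k + p.+1)%N = psi (ssub q (bump k.+1) (back q.+1 s)).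
    congr psi; rewrite /back.
    rewrite -/(ssub q.+1 (fun j => (p + q).+1 - q.+1 + j)%N s) ssub_comp.
      by apply: ssub_eq => j jp; rewrite /bump /=; lia.
    by move=> j jp; rewrite /bump; lia.
  by rewrite addnS -addSn exprD; ring.
by rewrite expr0 exprS; ring.
Qed.

Lemma cup_subproof p q (a : cohomology p) (b : cohomology q) :
  cupc (crep a) (crep b) \in @cocycles (p + q).
Proof.
apply/eqP/funext => s; rewrite leibniz !crepP.
by rewrite [X in X * _]/GRing.zero /= mul0r [X in _ * X]mulr0 mulr0 addr0.
Qed.

Definition cup p q (a : cohomology p) (b : cohomology q) : cohomology (p + q) :=
  cclass (exist (fun phi => phi \in @cocycles (p + q)) _ (cup_subproof a b)).

Lemma kron_cup p q (h : homology (p + q)) (a : cohomology p) (b : cohomology q) :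
  kron h (cup a b) = ev (cupc (crep a) (crep b)) (hrep h).
Proof. exact: kron_class. Qed.

End Homology.

Section Alt2.
Variable M : zmodType.

Definition is_alt2 : {pred (M -> M -> int)} := fun B =>
  `[< [/\ forall x y z, B (x + y) z = B x z + B y z,
          forall x y z, B x (y + z) = B x y + B x z &
          forall x y, B x y = - B y x] >].

Lemma is_alt2_closed : zmod_closed is_alt2.
Proof.
split=> [|B C /asboolP[B1 B2 B3] /asboolP[C1 C2 C3]]; apply/asboolP.
  by split=> *; rewrite ?addr0 ?oppr0.
split=> [x y z|x y z|x y].
- by rewrite -[LHS]/(B (x + y) z - C (x + y) z) B1 C1 opprD addrACA.
- by rewrite -[LHS]/(B x (y + z) - C x (y + z)) B2 C2 opprD addrACA.
- by rewrite -[LHS]/(B x y - C x y) B3 C3 -opprD.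
Qed.
HB.instance Definition _ :=
  GRing.isZmodClosed.Build (M -> M -> int) is_alt2 is_alt2_closed.

Definition alt2 := {B : M -> M -> int | B \in is_alt2}.
HB.instance Definition _ := SubChoice.on alt2.
HB.instance Definition _ := GRing.SubChoice_isSubZmodule.Build
  (M -> M -> int) is_alt2 alt2 is_alt2_closed.

Definition finitely_generated : Prop := exists s : seq M, forall x,
  exists c : nat -> int, x = \sum_(i < size s) s`_i *~ c i.
End Alt2.

Section Mu.
Variables (R : realType) (X : topologicalType).
Local Notation H_ n := (homology R X n).
Local Notation Hc n := (cohomology R X n).

Lemma cup_skew (s : H_ 2) (a b : Hc 1) :
  kron s (cup a b : Hc 2) = - kron s (cup b a : Hc 2).
Proof.
apply/eqP; rewrite -addr_eq0 -[X in X + _]/(kron (s : H_ (1 + 1)) (cup a b)).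
rewrite -[X in _ + X]/(kron (s : H_ (1 + 1)) (cup b a)) !kron_cup -evDl.
set phi := crep a; set psi := crep b.
pose f : cochain R X 1 := fun t => phi t * psi t.
have cE (g : cochain R X 1) t :
    cobd g t = g (back 1 t) - g (face (inord 1) t) + g (front 1 t).
  rewrite /cobd !big_ord_recl big_ord0 /= addr0 expr0 mul1r expr1 mulN1r.
  rewrite exprS expr1 mulrNN !mul1r addrA.
  congr (g _ - g _ + g _).
  - rewrite /face /back; congr smap; apply/funext => i; apply: val_inj => /=.
    by rewrite inordK //; case: i => -[|[]].
  - by congr (face _ t); apply: val_inj; rewrite /= inordK.
  - rewrite /face /front; congr smap; apply/funext => i; apply: val_inj => /=.
    by rewrite inordK //; case: i => -[|[]].
have -> : cupc phi psi + cupc psi phi = - cobd f.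
  apply/funext => t; rewrite -[LHS]/(cupc phi psi t + cupc psi phi t).
  rewrite -[RHS]/(- cobd f t) cE /f /cupc.
  have ephi := cE phi t; rewrite crepP -[LHS]/0 in ephi.
  have epsi := cE psi t; rewrite crepP -[LHS]/0 in epsi.
  have -> : phi (face (inord 1) t) = phi (back 1 t) + phi (front 1 t).
    by apply/eqP; rewrite -subr_eq0 -oppr_eq0 ephi; apply/eqP; ring.
  have -> : psi (face (inord 1) t) = psi (back 1 t) + psi (front 1 t).
    by apply/eqP; rewrite -subr_eq0 -oppr_eq0 epsi; apply/eqP; ring.
  by ring.
by rewrite evNl ev_cobd0 ?oppr0 //; exists f.
Qed.

Lemma cupDl (s : H_ 2) (a b c : Hc 1) :
  kron s (cup (a + b) c : Hc 2) = kron s (cup a c : Hc 2) + kron s (cup b c : Hc 2).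
Proof.
rewrite -[LHS]/(kron (s : H_ (1 + 1)) (cup (a + b) c)).
rewrite -[X in _ = X + _]/(kron (s : H_ (1 + 1)) (cup a c)).
rewrite -[X in _ = _ + X]/(kron (s : H_ (1 + 1)) (cup b c)) !kron_cup.
have [phi -> [f hf]] := crepD a b.
have -> : cupc (crep a + crep b + phi) (crep c) =
  cupc (crep a) (crep c) + cupc (crep b) (crep c) + cobd (cupc f (crep c)).
  apply/funext => t.
  rewrite -[RHS]/(cupc (crep a) (crep c) t + cupc (crep b) (crep c) t
                    + cobd (cupc f (crep c)) t).
  rewrite leibniz crepP hf /cupc.
  rewrite -[LHS]/((crep a (front 1 t) + crep b (front 1 t) + phi (front 1 t))
                  * crep c (back 1 t)).
  by rewrite [X in _ * (_ * X)]/GRing.zero /= !mulr0 addr0 !mulrDl.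
by rewrite !evDl [X in _ + X]ev_cobd0 ?addr0 //; exists (cupc f (crep c)).
Qed.

Lemma cupDr (s : H_ 2) (a b c : Hc 1) :
  kron s (cup a (b + c) : Hc 2) = kron s (cup a b : Hc 2) + kron s (cup a c : Hc 2).
Proof. by rewrite cup_skew cupDl opprD -!cup_skew. Qed.

Lemma mu_subproof (s : H_ 2) :
  (fun a b : Hc 1 => kron s (cup a b : Hc 2)) \in is_alt2 (M := Hc 1).
Proof.
apply/asboolP; split.
- exact: cupDl.
- exact: cupDr.
- exact: cup_skew.
Qed.

(* 1 + 1 is convertible to 2, so that cup a b is in H^2. *)
Definition mu (s : H_ 2) : alt2 (Hc 1) :=
  exist (fun B => B \in is_alt2 (M := Hc 1)) _ (mu_subproof s).

Lemma mu_additive : {morph mu : s t / s + t}.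
Proof.
move=> s t; apply: val_inj; apply/funext => a; apply/funext => b.
exact: kronDl.
Qed.

Definition mu_image : {pred alt2 (Hc 1)} := fun B => `[< exists s, mu s = B >].

Lemma mu0 : mu 0 = 0.
Proof. by apply: (addrI (mu 0)); rewrite -mu_additive !addr0. Qed.

Lemma mu_image_closed : zmod_closed mu_image.
Proof.
split=> [|B C /asboolP[s <-] /asboolP[t <-]]; apply/asboolP.
  by exists 0; exact: mu0.
have muB : mu (s - t) + mu t = mu s by rewrite -mu_additive subrK.
by exists (s - t); rewrite -muB addrK.
Qed.
HB.instance Definition _ :=
  GRing.isZmodClosed.Build (alt2 (Hc 1)) mu_image mu_image_closed.

Definition coker_mu : Type := Quotient.quot mu_image.
HB.instance Definition _ := GRing.Zmodule.on coker_mu.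
Definition coker_mu_class (B : alt2 (Hc 1)) : coker_mu :=
  \pi_(Quotient.quot mu_image) B.

Lemma wedge_form_subproof (x y : H_ 1) :
  (fun a b : Hc 1 => kron x a * kron y b - kron y a * kron x b)
    \in is_alt2 (M := Hc 1).
Proof.
by apply/asboolP; split=> [a b c|a b c|a b]; rewrite ?kronDr; ring.
Qed.

(* The form on H^1 defined by the element x /\ y of the second exterior power
   of H_1. *)
Definition wedge_form (x y : H_ 1) : alt2 (Hc 1) :=
  exist (fun B => B \in is_alt2 (M := Hc 1)) _ (wedge_form_subproof x y).
End Mu.

Section Hurewicz.
Variables (R : realType) (X : topologicalType) (x0 : X).
Local Notation I := (I01 R).

Lemma loop_sing_subproof (p : loop R x0) :
  continuous (fun t : Delta R 1 => p (clamp (bary t 1))).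
Proof.
apply: continuous_comp_fun _ (@cts_fun _ _ p); apply: continuous_clamp_fun; exact: bary_continuous.
Qed.

(* A loop as a singular 1-simplex, from vertex 0 to vertex 1 of Delta^1. *)
Definition loop_sing (p : loop R x0) : sing R X 1 := mkcts (@loop_sing_subproof p).

Lemma loop_sing_cycle (p : loop R x0) :
  (<< loop_sing p >> : chain R X 1) \in @cycles R X 1.
Proof.
apply/asboolP; rewrite /= bnd_gen !big_ord_recl big_ord0 expr0 scale1r addr0.
have h (i : 'I_2) : face i (loop_sing p) =
    mkcts (@continuous_cst_fun (Delta R 0) X x0).
  apply: sing_eqP => t; rewrite smapE.
  rewrite -[LHS]/(p (clamp (bary (push (lift i) t) 1))) -[RHS]/x0.
  have /set_mem [_] := valP t; rewrite big_ord1 => t0.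
  rewrite /bary pushE; case: i => -[|[|//]] hi.
    rewrite (bigD1 ord0) /=; last by rewrite -val_eqE /= inordK.
    rewrite [X in _ + X]big1 => [|j]; last by rewrite (ord1 j) eqxx andbF.
    have {}t0 : set_val t 0 ord0 = 1 by rewrite set_valE.
    by rewrite addr0 t0 -oneE path_one.
  rewrite big1 => [|j]; last by rewrite (ord1 j) -val_eqE /= inordK.
  by rewrite -zeroE path_zero.
by rewrite !h expr1 scaleN1r subrr.
Qed.

Definition hurewicz (g : pi1 R x0) : homology R X 1 :=
  hclass (exist (fun c => c \in @cycles R X 1) _ (loop_sing_cycle (repr g))).
End Hurewicz.

Section CW.
Variable R : realType.

Definition disk n : Type := set_type [set v : 'rV[R]_n | \sum_i v 0 i ^+ 2 <= 1].
HB.instance Definition _ n := Topological.on (disk n).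

Definition open_disk n : set (disk n) :=
  [set v | \sum_i (set_val v : 'rV[R]_n) 0 i ^+ 2 < 1].

(* Phi j is the characteristic map of the cell j, of dimension dim j. The four
   clauses are: continuity; every point lies in exactly one open cell, on which
   the characteristic map is injective; the boundary of a cell lies in finitely
   many open cells of lower dimension; Y has the weak topology. *)
Definition is_CW (Y : topologicalType) : Prop :=
  hausdorff_space Y /\
  exists (J : Type) (dim : J -> nat) (Phi : forall j, disk (dim j) -> Y),
  [/\ forall j, continuous (Phi j),
      forall y, exists! c : {j : J & disk (dim j)},
        open_disk (projT2 c) /\ Phi (projT1 c) (projT2 c) = y,
      forall j, exists K : set J, [/\ finite_set K,
        forall k, K k -> (dim k < dim j)%N &
        forall v, ~ open_disk v ->
          exists k w, [/\ K k, open_disk w & Phi k w = Phi j v]] &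
      forall A : set Y, closed A <-> forall j, closed (Phi j @^-1` A)].

Definition homotopic (X Y : topologicalType) (f g : X -> Y) : Prop :=
  exists H : X * I01 R -> Y, [/\ continuous H,
    forall x, H (x, zero) = f x & forall x, H (x, one) = g x].

Definition homotopy_equivalent (X Y : topologicalType) : Prop :=
  exists (f : X -> Y) (g : Y -> X), [/\ continuous f, continuous g,
    homotopic (g \o f) id & homotopic (f \o g) id].
End CW.

(* Main.v *)
From HB Require Import structures.
Require Import Defs.
From mathcomp Require Import freeg.
From mathcomp Require Import all_boot all_order all_algebra ssrAC generic_quotient.
From mathcomp Require Import ring_quotient zify ring lra.
From mathcomp Require Import all_classical all_reals topology normedtype.
From mathcomp Require Import continuous_path wedge_sigT.
Import GRing.Theory.
Local Open Scope classical_set_scope.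
Local Open Scope ring_scope.
Local Open Scope quotient_scope.

Set Implicit Arguments.
Unset Strict Implicit.
Unset Printing Implicit Defensive.

(** An element d of D is a loop whose class in H_1 vanishes, so it bounds a
    singular 2-chain C. Evaluating on C the cup products of pairs of classes of
    H^1 gives, up to sign, an alternating form B on H^1. Another choice of C
    differs from the first by a 2-cycle, so it changes B by an element of the
    image of mu: the class of B in the cokernel depends on d alone, and
    phi d is this class. This is the relation [bounding]. A product of
    loops is homotopic to their concatenation, which gives chains
    ([product_chain]) that make phi additive and show that the value of phi at a
    commutator of g and h is the class of the wedge of the classes of g and h
    ([bounding_commutator]). When g is torsion modulo D that wedge vanishes on
    H^1, so phi factors through D / (D~, G).

    Surjectivity: H_1 modulo torsion has a finite basis, H^1 has the dual basis
    ([homology_dual_basis], from the Smith normal form and from the description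
    of H_1 as abelianized fundamental group and of H^1 as its dual), and every
    alternating form is a combination of wedges of basis elements
    ([alt2_bounding]).

    Injectivity ([bounding_null_commDtilde]): if B is in the image of mu, then
    correcting C by a 2-cycle gives a chain bounding d on which all cup products
    vanish. The group E = G / (D~, G) is a central extension of the free
    abelian group H_1 / torsion. With h_i in E lifting its basis, each x in E is
    a central element k x times the ordered product of the h_i ^ x_i, where the
    x_i are the coordinates of x, and collecting powers gives
      k (x y) = k x + k y + \sum_(j < i) x_i y_j [h_i, h_j]
    ([central_part_mul]). Joining the base point to every point by a path turns
    each singular 1-simplex into an element of G ([sing_class]), which makes k a
    cochain with values in the centre of E; by the formula its coboundary is a
    combination of the cup products of the dual basis, so it vanishes on C. Then
    k d = 0, and k d is the image of d in E since the coordinates of d vanish.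

    The paths from the base point come from the CW structure: a union of path
    components of a CW complex is closed, as its preimage in each cell is empty
    or the whole disk, so a connected CW complex is path connected. *)

(** * Homomorphisms from a group to an abelian group *)

(** Induction for membership in a generated subgroup: a property closed under
    the group operations defines a subgroup. *)
Lemma generated_ind (G : groupType) (S : set G) (P : G -> Prop) :
  P 1%g -> (forall x y, P x -> P y -> P (x * y)%g) -> (forall x, P x -> P x^-1%g) ->
  (forall s, S s -> P s) -> forall x, x \in generated S -> P x.
Proof.
move=> P1 PM PV PS x.
pose p : {pred G} := fun y => `[< P y >].
have pM : mulg_closed p by move=> y z /asboolP Py /asboolP Pz; apply/asboolP/PM.
have p1 : 1%g \in p by exact/asboolP.
have pV : invg_closed p by move=> y /asboolP Py; apply/asboolP/PV.
pose H : groupClosed G := HB.pack p (isMulClosed.Build G p pM)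
  (isMul1Closed.Build G p p1) (isInvClosed.Build G p pV).
by move=> /asboolP /(_ H) Hx; apply/asboolP/Hx => s Ss; apply/asboolP/PS.
Qed.

Section HomToAbelian.
Variables (G : groupType) (A : zmodType) (f : G -> A).
Hypothesis fM : forall x y, f (x * y)%g = f x + f y.

Lemma hom1 : f 1%g = 0.
Proof. by apply: (@addIr _ (f 1%g)); rewrite -fM mulg1 add0r. Qed.
Lemma homV x : f x^-1%g = - f x.
Proof. by apply: (@addIr _ (f x)); rewrite -fM mulVg hom1 addNr. Qed.
Lemma homX x n : f (x ^+ n)%g = f x *+ n.
Proof. by elim: n => [|n IH]; rewrite ?expg0 ?mulr0n ?hom1 // expgS fM IH mulrS. Qed.

Lemma hom_derived x : x \in derived G -> f x = 0.
Proof.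
move: x; apply: generated_ind => [|x y fx fy|x fx|_ [a [b [_ _ ->]]]].
- exact: hom1.
- by rewrite fM fx fy addr0.
- by rewrite homV fx oppr0.
- by rewrite !fM !homV [X in X - _]addrAC subrr add0r subrr.
Qed.
End HomToAbelian.

Section DerivedExt.
Variables (G : groupType) (A : zmodType) (f f' : subg_of (derived G) -> A).
Hypothesis fM : forall x y, f (x * y)%g = f x + f y.
Hypothesis fM' : forall x y, f' (x * y)%g = f' x + f' y.
Hypothesis ff' : forall a b d, val d = (a * b * a^-1 * b^-1)%g -> f d = f' d.

(** The elements of D on which f and f' agree form a subgroup of G, so the values
    on commutators determine the isomorphism. *)
Lemma derived_hom_ext : f =1 f'.
Proof.
suff H x : x \in derived G -> exists2 d : subg_of (derived G), val d = x & f d = f' d.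
  by move=> d; have [_ /val_inj ->] := H (val d) (valP d).
move: x; apply: generated_ind => [|x y [d <- fd] [e <- fe]|x [d <- fd]|_ [a [b [_ _ ->]]]].
- by exists 1%g; rewrite ?val1 // (hom1 fM) (hom1 fM').
- by exists (d * e)%g; rewrite ?valM // fM fM' fd fe.
- by exists d^-1%g; rewrite ?gmulfV // (homV fM) (homV fM') fd.
have cD : (a * b * a^-1 * b^-1)%g \in derived G by apply: generated_ge; exists a, b.
by exists (exist (fun x => x \in derived G) _ cD) => //; exact: ff'.
Qed.
End DerivedExt.

Lemma pi_gquot1 (G : groupType) (N : normalClosed G) (x : G) :
  (\pi_(gquot N) x == 1%g) = (x \in N).
Proof.
have -> : (1%g : gquot N) = \pi_(gquot N) 1%g by [].
rewrite eq_sym; apply/eqP/idP => [/gequivP|xN]; first by rewrite invg1 mul1g.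
by apply/gequivP; rewrite invg1 mul1g.
Qed.

(** * Nilpotent groups of class two *)

Section Center.
Variable E : groupType.
Local Open Scope group_scope.

Definition gcenter : {pred E} := fun x => `[< forall y, commute x y >].

Lemma gcenterP x : reflect (forall y, x * y = y * x) (x \in gcenter).
Proof. exact: asboolP. Qed.

(** The centre as a zmodType, so that it can be the coefficient group of
    singular cochains. *)
Definition zcenter := {x : E | x \in gcenter}.
HB.instance Definition _ := SubChoice.on zcenter.

Lemma gcenter1 : 1 \in gcenter.
Proof. by apply/gcenterP => y; rewrite mulg1 mul1g. Qed.
Lemma gcenterM : mulg_closed gcenter.
Proof.
move=> x y /gcenterP xc /gcenterP yc; apply/gcenterP => z.
by rewrite -mulgA yc !mulgA xc.
Qed.
Lemma gcenterV : invg_closed gcenter.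
Proof.
move=> x /gcenterP xc; apply/gcenterP => z.
by apply: (mulgI x); rewrite mulVKg !mulgA xc mulgK.
Qed.

Definition zc0 : zcenter := exist _ 1 gcenter1.
Definition zcadd (x y : zcenter) : zcenter :=
  exist _ (val x * val y) (gcenterM (valP x) (valP y)).
Definition zcopp (x : zcenter) : zcenter := exist _ (val x)^-1 (gcenterV (valP x)).

Lemma zcaddA : associative zcadd.
Proof. by move=> x y z; apply: val_inj; rewrite /= mulgA. Qed.
Lemma zcaddC : commutative zcadd.
Proof. by move=> x y; apply: val_inj; rewrite /=; have /gcenterP := valP x; apply. Qed.
Lemma zcadd0 : left_id zc0 zcadd.
Proof. by move=> x; apply: val_inj; rewrite /= mul1g. Qed.
Lemma zcaddN : left_inverse zc0 zcopp zcadd.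
Proof. by move=> x; apply: val_inj; rewrite /= mulVg. Qed.
HB.instance Definition _ :=
  GRing.isZmodule.Build zcenter zcaddA zcaddC zcadd0 zcaddN.

Lemma val_zcD (x y : zcenter) : val (x + y)%R = val x * val y. Proof. by []. Qed.

Lemma zcC (z : zcenter) y : val z * y = y * val z.
Proof. by have /gcenterP := valP z; apply. Qed.

End Center.

Lemma derived_quotient_central (G : groupType) (x : gquot (derived G)) :
  x \in @gcenter (gquot (derived G)).
Proof.
apply/gcenterP => y; rewrite -[x]reprK -[y]reprK -!gmulfM; apply/gequivP.
apply: generated_ge; exists (repr y)^-1%g, (repr x)^-1%g.
by rewrite !invgK invgM !mulgA.
Qed.

Section IntegerPowers.
Variable E : groupType.
Local Open Scope group_scope.

Definition zexp (x : E) (n : int) : E :=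
  match n with Posz m => x ^+ m | Negz m => x ^- m.+1 end.

Lemma zexpS x (n : int) : zexp x (n + 1)%R = zexp x n * x.
Proof.
case: n => [n|n].
  by rewrite -PoszD addn1 /= expgSr.
have -> : (Negz n + 1 = - n%:Z :> int)%R.
  by rewrite NegzE -addn1 PoszD opprD subrK.
case: n => [|n]; first by rewrite oppr0 /= expg0 expg1 mulVg.
by rewrite -NegzE /= [x ^+ n.+2]expgS invgM mulgVK.
Qed.

Lemma zexpD x (m n : int) : zexp x (m + n)%R = zexp x m * zexp x n.
Proof.
have P k l : zexp x (l + Posz k)%R = zexp x l * x ^+ k.
  elim: k l => [|k IH] l; first by rewrite addr0 mulg1.
  by rewrite -addn1 PoszD addrA zexpS IH addn1 expgSr mulgA.
case: n => [n|n]; first exact: P.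
apply: (mulIg (x ^+ n.+1)); rewrite -P NegzE subrK.
by rewrite mulgVK.
Qed.

Lemma hom_zexp (A : zmodType) (f : E -> A) :
  (forall x y, f (x * y) = (f x + f y)%R) -> forall x n, f (zexp x n) = (f x *~ n)%R.
Proof. by move=> fM x [] n /=; rewrite ?(homV fM) (homX fM). Qed.
End IntegerPowers.

(** E is a central extension of Z^r, given by its coordinates a i and by lifts
    g i of the standard basis. *)
Section CentralSection.
Variables (E : groupType) (r : nat) (g : 'I_r -> E) (a : 'I_r -> E -> int).
Local Open Scope group_scope.
Hypothesis aM : forall i x y, a i (x * y) = (a i x + a i y)%R.
Hypothesis ag : forall i j, a i (g j) = (i == j)%:R%R.
Hypothesis aker : forall x, (forall i, a i x = 0%R) -> x \in @gcenter E.

(** The coordinates of a commutator vanish. *)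
Lemma comm_central x y : x * y * x^-1 * y^-1 \in @gcenter E.
Proof.
by apply: aker => i; rewrite !aM !(homV (aM i)) [X in (X - _)%R]addrAC subrr
  add0r subrr.
Qed.

(** Locked, for otherwise unification unfolds a central commutator into a
    product and rewriting with associativity enters it. *)
Definition zcomm x y : zcenter E :=
  locked (exist (fun z => z \in @gcenter E) _ (comm_central x y)).

Lemma zcommE x y : x * y = val (zcomm x y) * (y * x).
Proof. by rewrite /zcomm -lock /= !mulgA !mulgVK. Qed.

Lemma zcomm_eq (z : zcenter E) x y : x * y = val z * (y * x) -> zcomm x y = z.
Proof. by rewrite zcommE => /mulIg /val_inj. Qed.

Lemma zcommDl x x' y : zcomm (x * x') y = (zcomm x y + zcomm x' y)%R.
Proof.
apply: zcomm_eq; rewrite val_zcD -mulgA (zcommE x' y) mulgA -(zcC _ x)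
  -mulgA (mulgA x y) (zcommE x y).
by rewrite !mulgA (zcC (zcomm x y)).
Qed.

Lemma zcommDr x y y' : zcomm x (y * y') = (zcomm x y + zcomm x y')%R.
Proof.
apply: zcomm_eq; rewrite val_zcD mulgA (zcommE x y) -!mulgA (zcommE x y')
  [y * (_ * _)]mulgA -(zcC _ y).
by rewrite !mulgA.
Qed.

Definition normal_word (v : 'I_r -> int) : E := \prod_(i < r) zexp (g i) (v i).

Lemma zcomm_word x n m (h : 'I_m -> E) w :
  zcomm (zexp x n) (\prod_(i < m) zexp (h i) (w i)) =
  (\sum_i zcomm x (h i) *~ (n * w i))%R.
Proof.
have D1 y x1 x2 : zcomm (x1 * x2) y = (zcomm x1 y + zcomm x2 y)%R.
  exact: zcommDl.
have D2 y1 y2 : zcomm (zexp x n) (y1 * y2) =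
    (zcomm (zexp x n) y1 + zcomm (zexp x n) y2)%R by exact: zcommDr.
rewrite (big_morph _ D2 (hom1 D2)); apply: eq_bigr => i _.
rewrite (hom_zexp D2) (hom_zexp (D1 (h i))).
by rewrite mulrzA_C mulrC.
Qed.

Lemma coord_normal_word v i : a i (normal_word v) = v i.
Proof.
rewrite /normal_word.
rewrite (big_morph (a i) (aM i) (hom1 (aM i))) (bigD1 i) //= big1 => [|j ji].
  by rewrite (hom_zexp (aM i)) ag eqxx addr0 intz.
by rewrite (hom_zexp (aM i)) ag eq_sym (negbTE ji) mul0rz.
Qed.

Definition structure_constant (i j : 'I_r) : zcenter E :=
  (if (j < i)%N then zcomm (g i) (g j) else 0)%R.

(** Collection of the powers of the g i by induction on r: moving the power of
    the last generator of the first word across the whole second word produces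
    the commutators of that generator with the previous ones. *)
Lemma normal_word_mul v w :
  normal_word v * normal_word w =
  val (\sum_i \sum_j structure_constant i j *~ (v i * w j))%R
  * normal_word (fun i => v i + w i)%R.
Proof.
rewrite /normal_word /structure_constant.
elim: r g v w => [|m IH] h v w; first by rewrite !big_ord0 !mulg1.
have -> : (\sum_(i < m.+1) \sum_(j < m.+1) (if (j < i)%N then zcomm (h i) (h j) else 0)
      *~ (v i * w j))%R =
    (\sum_(i < m) \sum_(j < m) (if (j < i)%N then zcomm (h (widen_ord (leqnSn m) i))
        (h (widen_ord (leqnSn m) j)) else 0)
      *~ (v (widen_ord (leqnSn m) i) * w (widen_ord (leqnSn m) j)) +
    zcomm (zexp (h ord_max) (v ord_max))
       (\prod_(i < m) zexp (h (widen_ord (leqnSn m) i))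
                           (w (widen_ord (leqnSn m) i))))%R.
  rewrite (zcomm_word _ _ (h \o _) (w \o _)) !big_ord_recr /= ltnn mul0rz addr0.
  congr (_ + _)%R; apply: eq_bigr => i _.
    by rewrite big_ord_recr /= ltnNge ltnW //= mul0rz addr0.
  by rewrite /= ltn_ord.
rewrite val_zcD !big_ord_recr; set wd := widen_ord _.
set A := \prod_(i < m) _; set B := \prod_(i < m) _.
rewrite zexpD.
have := IH (h \o wd) (v \o wd) (w \o wd); rewrite -[X in X * _ = _]/A -[X in _ * X = _]/B.
set S := (X in val X * _); set W := \prod_(_ < m) _.
rewrite -[X in val X * _]/S -[X in _ = _ * (X * _)]/W.
set y := zexp _ _; set y' := zexp _ _ => AB.
rewrite -mulgA (mulgA y) (zcommE y B) !mulgA -(zcC _ A) -!mulgA.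
rewrite (mulgA A) AB !mulgA; congr (_ * _ * _ * _).
by rewrite zcC.
Qed.

Lemma central_part_subproof x :
  x * (normal_word (a^~ x))^-1 \in @gcenter E.
Proof. by apply: aker => i; rewrite aM (homV (aM i)) coord_normal_word subrr. Qed.

(** The failure of x to be the normal word with the same coordinates. *)
Definition central_part x : zcenter E :=
  locked (exist (fun z => z \in @gcenter E) _ (central_part_subproof x)).

(** The 2-cocycle of the central extension E of Z^r, computed for the section
    given by normal words, is bilinear in the coordinates. *)
Lemma central_part_mul x y : (central_part (x * y) = central_part x + central_part y
   + \sum_i \sum_j structure_constant i j *~ (a i x * a j y))%R.
Proof.
have E1 u : u = val (central_part u) * normal_word (a^~ u).
  by rewrite /central_part -lock /= mulgVK.
have Exy : normal_word (a^~ (x * y)) = normal_word (fun i => a i x + a i y)%R.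
  by apply: eq_bigr => i _; rewrite aM.
apply: val_inj; apply: (mulIg (normal_word (a^~ (x * y)))).
rewrite -E1 [x in LHS]E1 [y in LHS]E1 !val_zcD.
rewrite -[RHS]mulgA Exy -normal_word_mul.
by rewrite !mulgA; congr (_ * _); rewrite -!mulgA; congr (_ * _); rewrite zcC.
Qed.

Lemma central_part_id x : (forall i, a i x = 0)%R -> val (central_part x) = x.
Proof.
move=> ax; rewrite /central_part -lock /= /normal_word big1 ?invg1 ?mulg1 // => i _.
by rewrite ax.
Qed.
End CentralSection.

(** * Dual systems in finitely generated abelian groups *)

Section DualSystem.
Variables (M : zmodType) (n : nat) (s : 'I_n -> M).
Import Order.TTheory Num.Theory.

Definition lincomb (c : 'rV[int]_n) : M := \sum_i s i *~ c 0 i.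

Lemma lincombB c d : lincomb (c - d) = lincomb c - lincomb d.
Proof.
rewrite /lincomb -sumrB; apply: eq_bigr => i _; rewrite !mxE.
by rewrite mulrzBr.
Qed.

Lemma lincomb_mul k (c : 'rV[int]_k) (A : 'M_(k, n)) :
  lincomb (c *m A) = \sum_i lincomb (row i A) *~ c 0 i.
Proof.
rewrite /lincomb; under eq_bigr => j _.
  rewrite mxE mulrz_sumr; under eq_bigr do rewrite mulrC mulrzA. over.
rewrite exchange_big; apply: eq_bigr => i _; rewrite mulrz_suml.
by apply: eq_bigr => j _; rewrite mxE.
Qed.

Definition relations k (A : 'M[int]_(k, n)) : Prop :=
  forall i, lincomb (row i A) = 0.

Lemma relations_mul k l (B : 'M_(l, k)) (A : 'M_(k, n)) :
  relations A -> relations (B *m A).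
Proof.
move=> rA i; rewrite row_mul lincomb_mul big1 // => j _.
by rewrite rA mul0rz.
Qed.

(** A matrix of relations of maximal rank over the rationals: a relation outside
    its row space could be added to it and would increase the rank. *)
Lemma max_relations : exists k (A : 'M[int]_(k, n)), relations A /\
  forall c : 'rV_n, lincomb c = 0 ->
    ((map_mx intr c : 'rV[rat]_n) <= (map_mx intr A : 'M[rat]_(k, n)))%MS.
Proof.
pose P (rho : nat) := `[< exists k (A : 'M[int]_(k, n)),
  relations A /\ \rank (map_mx intr A : 'M[rat]_(k, n)) = rho >].
have P0 : exists rho, P rho.
  exists 0%N; apply/asboolP; exists 0%N, 0; split; first by case.
  by rewrite map_mx0 mxrank0.
have Pn rho : P rho -> (rho <= n)%N.
  by move=> /asboolP[k [A [_ <-]]]; exact: rank_leq_col.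
case: (ex_maxnP P0 Pn) => rho /asboolP[k [A [rA rkA]]] rho_max.
exists k, A; split=> // c c0.
have rAc : relations (col_mx A c).
  move=> i; case: (split_ordP i) => j ->; first by rewrite rowKu.
  by rewrite rowKd (ord1 j) row_id.
have sA : ((map_mx intr A : 'M[rat]_(k, n)) <=
     (map_mx intr (col_mx A c) : 'M[rat]_(k + 1, n)))%MS.
  by rewrite map_col_mx -addsmxE addsmxSl.
have : (\rank (map_mx intr (col_mx A c) : 'M[rat]_(_, n)) <= rho)%N.
  by apply: rho_max; apply/asboolP; exists (k + 1)%N, (col_mx A c).
rewrite -rkA => rk; have := mxrank_leqif_sup sA.
rewrite /leqif eqn_leq rk (mxrankS sA) => -[_ /esym].
rewrite map_col_mx -addsmxE => /(submx_trans _); apply; exact: addsmxSr.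
Qed.

Hypothesis s_gen : forall x, exists c, x = lincomb c.

(** Write a maximal matrix of relations as L D R in Smith normal form and take
    the rows of R as new generators. Those at a nonzero entry of D are torsion,
    and every relation has coordinate zero at the others, which are therefore the
    basis h with well-defined coordinate functions a. *)
Lemma dual_system : exists r (h : 'I_r -> M) (a : 'I_r -> M -> int),
  [/\ forall i x y, a i (x + y) = a i x + a i y,
      forall i j, a i (h j) = (i == j)%:R &
      forall x, (forall i, a i x = 0) -> exists2 N, (0 < N)%N & x *+ N = 0].
Proof.
have [k [A [rA Amax]]] := max_relations.
have [L uL [R uR [d _ AE]]] := int_Smith_normal_form A.
set D := (X in L *m X *m R) in AE.
(* The columns where D vanishes; D may have fewer rows than columns. *)
pose J : {set 'I_n} := finset (fun j : 'I_n => (k <= j)%N || (d`_j == 0)).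
pose crd (c : 'rV_n) := c *m invmx R.
have D0 i j : j \in J -> D i j = 0.
  rewrite inE mxE; case: (i =P j :> nat) => [ij|_]; last by rewrite mulr0n.
  by rewrite -ij leqNgt ltn_ord /= => /eqP ->; rewrite mul0rn.
have relJ c j : lincomb c = 0 -> j \in J -> crd c 0 j = 0.
  move=> /Amax /submxP[w cE] jJ.
  apply/eqP; rewrite -(@intr_eq0 rat); apply/eqP.
  have -> : ((crd c 0 j)%:~R : rat) = (map_mx intr (crd c) : 'rV[rat]_n) 0 j.
    by rewrite [RHS]mxE.
  rewrite map_mxM cE -mulmxA -map_mxM AE mulmxK //.
  rewrite map_mxM mulmxA mxE big1 // => i _.
  by rewrite [map_mx _ D _ _]mxE D0 // mulr0.
have torsJ j : j \notin J -> lincomb (row j R) *~ d`_j = 0 /\ d`_j != 0.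
  rewrite inE negb_or -ltnNge => /andP[jk dj]; split=> //.
  have : lincomb (row (Ordinal jk) (invmx L *m A)) = 0 by exact: relations_mul.
  rewrite AE -mulmxA mulKmx // row_mul lincomb_mul (bigD1 j) //= big1 => [|i ij].
    by rewrite !mxE eqxx mulr1n addr0.
  have ji : (j == i :> nat) = false by apply/negbTE; rewrite eq_sym.
  by rewrite !mxE /= ji mulr0n mulr0z.
pose cf x := projT1 (cid (s_gen x)).
have cfE x : lincomb (cf x) = x by rewrite /cf; case: cid.
have crdE c c' j : j \in J -> lincomb c = lincomb c' -> crd c 0 j = crd c' 0 j.
  move=> jJ cc'; apply/eqP; rewrite -subr_eq0; apply/eqP.
  have := relJ (c - c') j; rewrite lincombB cc' subrr => /(_ erefl jJ).
  by rewrite /crd mulmxBl !mxE.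
exists #|J|, (fun i => lincomb (row (enum_val i) R)),
  (fun i x => crd (cf x) 0 (enum_val i)).
split=> [i x y|i j|x x0].
- rewrite (crdE _ (cf x + cf y)) ?enum_valP //.
    by rewrite /crd mulmxDl mxE.
  by rewrite cfE -[cf y]opprK lincombB -[- cf y]sub0r lincombB !cfE
     [lincomb 0]big1 ?sub0r ?opprK // => l _; rewrite mxE mulr0z.
- rewrite (crdE _ (row (enum_val j) R)) ?enum_valP //.
  rewrite /crd -row_mul mulmxV // !mxE.
  by rewrite (inj_eq enum_val_inj) eq_sym.
exists (\prod_(j | j \notin J) absz (d`_j)%R)%N.
  by apply: prodn_cond_gt0 => j /torsJ[_]; rewrite absz_gt0.
rewrite -[x]cfE -[cf x](mulmxKV uR) lincomb_mul -[X in X *+ _]/(\sum_j _).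
rewrite -sumrMnl big1 // => j _; have [jJ|jJ] := boolP (j \in J).
  have := x0 (enum_rank_in jJ j); rewrite enum_rankK_in // => ->.
  by rewrite mulr0z mul0rn.
have [tj _] := torsJ j jJ.
rewrite (bigD1 j) //= mulrnA [X in X *+ _]pmulrn mulrzAC -pmulrn.
have -> : (lincomb (row j R) *+ absz d`_j) = 0.
  case: (d`_j) tj => m /=; rewrite ?NegzE ?mulrNz // => /eqP.
  by rewrite oppr_eq0 => /eqP.
by rewrite ?mul0rz ?mul0rn.
Qed.
End DualSystem.

(** * Path-connectedness *)

Section PathConnected.
Variable R : realType.
Import Order.TTheory Num.Theory numFieldNormedType.Exports.
Local Notation I := (I01 R).

Definition joined (X : topologicalType) (x y : X) : Prop :=
  inhabited {path I from x to y}.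

Lemma joined_sym (X : topologicalType) (x y : X) : joined x y -> joined y x.
Proof. by move=> [p]; split; exact: path_inverse p. Qed.

Lemma joined_trans (X : topologicalType) (x y z : X) :
  joined x y -> joined y z -> joined x z.
Proof. by move=> [p] [q]; split; exact: path_concat p q. Qed.

Lemma joined_map (X Y : topologicalType) (f : X -> Y) (x y : X) :
  continuous f -> joined x y -> joined (f x) (f y).
Proof.
move=> cf [p]; split.
apply: (@mk_path _ _ _ _ (fun t => f (p t))).
- exact: continuous_comp_fun (@cts_fun _ _ p) cf.
- by rewrite path_zero.
- by rewrite path_one.
Qed.

Lemma homotopic_joined (X Y : topologicalType) (f g : X -> Y) x :
  homotopic R f g -> joined (f x) (g x).
Proof.
move=> [H [cH H0 H1]]; split.
apply: (@mk_path _ _ _ _ (fun t => H (x, t))) => //.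
apply: continuous_comp_fun _ cH; apply: continuous_pair; last by move=> ?; exact: cvg_id.
exact: continuous_cst_fun.
Qed.

(** Every point is joined to the centre of the disk by a radius. *)
Lemma disk_joined n (v w : disk R n) : joined v w.
Proof.
pose sc (v : disk R n) (t : I) : 'rV[R]_n := ival t *: set_val v.
have sc_in u t : sc u t \in [set v : 'rV[R]_n | \sum_i v 0 i ^+ 2 <= 1].
  have /set_mem /= u1 := valP u; rewrite inE /=.
  under eq_bigr do rewrite mxE exprMn.
  rewrite -mulr_sumr mulr_ile1 ?exprn_ge0 ?exprn_ile1 ?ival_ge0 ?ival_le1 //.
  by apply: sumr_ge0 => i _; exact: sqr_ge0.
pose scd u t : disk R n :=
  exist (fun v => v \in [set v : 'rV[R]_n | \sum_i v 0 i ^+ 2 <= 1]) _ (sc_in u t).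
have csc u : continuous (scd u).
  apply: continuous_set_type; apply: continuous_mx => i j.
  rewrite /comp set_valE /= /sc.
  have -> : (fun x => (ival x *: set_val u) i j) = (fun x => ival x * set_val u i j).
    by apply/funext => x; rewrite mxE.
  by apply: continuousM_fun; [exact: continuous_ival_fun|exact: continuous_cst_fun].
have E0 u : scd u zero = scd v zero.
  by apply: val_inj; rewrite /= /sc ival0 !scale0r.
have E1 u : scd u one = u by apply: val_inj; rewrite /= /sc ival1 scale1r.
have h u : joined (scd v zero) u.
  by split; apply: (@mk_path _ _ _ _ (scd u)) => //; exact: csc.
exact: joined_trans (joined_sym (h v)) (h w).
Qed.

(** The preimage of A under a characteristic map is empty or everything, because
    disks are path connected. *)
Lemma CW_joined_closed (Y : topologicalType) (A : set Y) : is_CW R Y ->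
  (forall x y, joined x y -> A x -> A y) -> closed A.
Proof.
move=> [_ [J [dim [Phi [cPhi _ _ weak]]]]] AJ; apply/weak => j.
have [[v Av]|nA] := pselect (exists v, A (Phi j v)).
  have -> : Phi j @^-1` A = setT.
    apply/seteqP; split=> // w _; apply: AJ Av.
    exact: joined_map (cPhi j) (disk_joined v w).
  exact: closedT.
have -> : Phi j @^-1` A = set0; last exact: closed0.
by apply/seteqP; split=> // v Av; apply: nA; exists v.
Qed.

(** The points of X sent to the path component of f x are clopen, hence all of X;
    the path in Y from f x to f y is carried back to X by g. *)
Lemma homotopy_CW_joined (X : topologicalType) : connected [set: X] ->
  (exists Y : topologicalType, is_CW R Y /\ homotopy_equivalent R X Y) ->
  forall x y : X, joined x y.
Proof.
move=> cX [Y [CWY [f [g [cf cg gf _]]]]] x y.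
pose B := f @^-1` [set z | joined (f x) z].
have BT : B = setT.
  have closedB (A : set Y) :
      (forall x y, joined x y -> A x -> A y) -> closed (f @^-1` A).
    move=> /(CW_joined_closed CWY) cA.
    by apply: preimage_closed => //.
  apply: cX.
  - by exists x; split; exact: path_const.
  - exists B; last by rewrite setTI.
    rewrite -[B]setCK; apply: closed_openC; apply: (closedB (~` _)) => u v uv nu vx.
    by apply: nu; exact: joined_trans vx (joined_sym uv).
  - exists B; last by rewrite setTI.
    apply: closedB => u v uv xu; exact: joined_trans xu uv.
have : B y by rewrite BT.
move=> /(joined_map cg) fxy.
apply: joined_trans (homotopic_joined y gf).
exact: joined_trans (joined_sym (homotopic_joined x gf)) fxy.
Qed.
End PathConnected.

(** * Barycentric coordinates *)

Section Simplices.
Variable R : realType.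
Import Order.TTheory Num.Theory numFieldNormedType.Exports.
Local Notation I := (I01 R).

Lemma bary_ge0 n (t : Delta R n) i : 0 <= bary t i.
Proof. by have /set_mem [t0 _] := valP t; exact: t0. Qed.

Lemma baryE n (t : Delta R n) (i : 'I_n.+1) : set_val t 0 i = bary t i.
Proof. by rewrite /bary inord_val. Qed.

Lemma bary_sum n (t : Delta R n) : \sum_(i < n.+1) bary t i = 1.
Proof.
have /set_mem [_ <-] := valP t; apply: eq_bigr => i _; rewrite -baryE.
by rewrite set_valE.
Qed.

Lemma bary_sum1 (t : Delta R 1) : bary t 0 + bary t 1 = 1.
Proof. by rewrite -(bary_sum t) !big_ord_recl big_ord0 addr0. Qed.

Lemma bary_sum2 (t : Delta R 2) : bary t 0 + bary t 1 + bary t 2 = 1.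
Proof. by rewrite -(bary_sum t) !big_ord_recl big_ord0 addr0 addrA. Qed.

Lemma bary_inj n (t u : Delta R n) :
  (forall i, (i <= n)%N -> bary t i = bary u i) -> t = u.
Proof.
move=> tu; apply: val_inj; apply/rowP => i.
by have := tu i; rewrite -!baryE !set_valE -ltnS ltn_ord; apply.
Qed.

Lemma bary_inj1 (t u : Delta R 1) : bary t 1 = bary u 1 -> t = u.
Proof.
move=> tu; have tu0 : bary t 0 = bary u 0.
  by apply: (@addIr _ (bary t 1)); rewrite bary_sum1 tu bary_sum1.
by apply: bary_inj => -[|[|//]].
Qed.

Lemma bary_inj2 (t u : Delta R 2) :
  bary t 0 = bary u 0 -> bary t 2 = bary u 2 -> t = u.
Proof.
move=> tu0 tu2; have tu1 : bary t 1 = bary u 1.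
  apply: (@addrI _ (bary t 0)); apply: (@addIr _ (bary t 2)).
  by rewrite bary_sum2 tu0 tu2 bary_sum2.
by apply: bary_inj => -[|[|[|//]]].
Qed.

Lemma bary_push m n (f : 'I_m.+1 -> 'I_n.+1) (t : Delta R m) k : (k <= n)%N ->
  bary (push f t) k = \sum_(i < m.+1 | f i == k :> nat) bary t i.
Proof.
move=> kn; rewrite /bary pushE; apply: eq_big => i.
  by rewrite -val_eqE /= inordK.
by rewrite inord_val.
Qed.

Definition face_pt (i : 'I_3) (t : Delta R 1) : Delta R 2 := push (lift i) t.

Lemma bary_face (i : 'I_3) (t : Delta R 1) k : (k <= 2)%N ->
  bary (face_pt i t) k = nth 0 (take i [:: bary t 0; bary t 1] ++
     0 :: drop i [:: bary t 0; bary t 1]) k.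
Proof.
rewrite /face_pt => k2; rewrite bary_push // big_mkcond !big_ord_recl big_ord0 /=.
by case: i k k2 => -[|[|[|//]]] hi [|[|[|//]]] _; rewrite /= ?addr0 ?add0r.
Qed.

Lemma simplex_pt_subproof n (f : 'I_n.+1 -> R) :
  (forall i, 0 <= f i) -> \sum_i f i = 1 -> (\row_i f i) \in stdsimplex R n.
Proof.
move=> f0 f1; rewrite inE; split=> [i|]; first by rewrite mxE.
by rewrite -[RHS]f1; apply: eq_bigr => i _; rewrite mxE.
Qed.

Lemma continuous_simplex (T : topologicalType) n (F : T -> Delta R n) :
  (forall i, (i <= n)%N -> continuous (fun x => bary (F x) i)) -> continuous F.
Proof.
move=> cF; apply: continuous_set_type; apply: continuous_mx => i j.
have := cF j; rewrite -ltnS ltn_ord => /(_ isT); congr (continuous _).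
by apply/funext => x; rewrite /bary /comp (ord1 i) inord_val.
Qed.

Lemma simplex_family (T : topologicalType) n (f : nat -> T -> R) :
  (forall i x, (i <= n)%N -> 0 <= f i x) ->
  (forall x, \sum_(i < n.+1) f i x = 1) ->
  (forall i, (i <= n)%N -> continuous (f i)) ->
  exists2 F : T -> Delta R n, continuous F &
    forall i x, (i <= n)%N -> bary (F x) i = f i x.
Proof.
move=> f0 f1 cf.
have fx x : (\row_(i < n.+1) f i x) \in stdsimplex R n.
  by apply: simplex_pt_subproof => // i; apply: f0; rewrite -ltnS.
pose F x : Delta R n := exist (fun v => v \in stdsimplex R n) _ (fx x).
have FE i x : (i <= n)%N -> bary (F x) i = f i x.
  by move=> i_n; rewrite /bary set_valE /= mxE inordK.
exists F => //; apply: continuous_simplex => i i_n.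
suff -> : (fun x => bary (F x) i) = f i by exact: cf.
by apply/funext => x; exact: FE.
Qed.

End Simplices.

(** * Paths as singular simplices *)

Section PathSimplices.
Variables (R : realType) (X : topologicalType).
Import Order.TTheory Num.Theory numFieldNormedType.Exports.
Local Notation I := (I01 R).

Lemma seg_subproof : exists2 F : I -> Delta R 1, continuous F &
  forall t, bary (F t) 1 = ival t.
Proof.
have [||i i1|F cF FE] := @simplex_family R I 1
    (fun i t => if i == 0%N then 1 - ival t else ival t).
- move=> [|i] t _ /=; last exact: ival_ge0.
  by rewrite subr_ge0 ival_le1.
- by move=> t; rewrite !big_ord_recl big_ord0 /= addr0 subrK.
- case: i i1 => [|i] _ /=; last exact: continuous_ival_fun.
  by apply: continuousB_fun; [exact: continuous_cst_fun|exact: continuous_ival_fun].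
- by exists F => // t; rewrite FE.
Qed.

(** The parametrization of the 1-simplex by the unit interval, inverse to the
    coordinate at vertex 1. *)
Definition seg : I -> Delta R 1 := s2val (cid2 seg_subproof).

Lemma seg_continuous : continuous seg.
Proof. exact: s2valP (cid2 seg_subproof). Qed.

Lemma bary_seg1 t : bary (seg t) 1 = ival t.
Proof. exact: s2valP' (cid2 seg_subproof) t. Qed.

Lemma bary_seg0 t : bary (seg t) 0 = 1 - ival t.
Proof. by rewrite -(bary_sum1 (seg t)) bary_seg1 addrK. Qed.

Lemma bary_le1 (t : Delta R 1) : 0 <= bary t 1 <= 1.
Proof.
by rewrite bary_ge0 -(bary_sum1 t) lerDr bary_ge0.
Qed.

Lemma seg_clamp (t : Delta R 1) : seg (clamp (bary t 1)) = t.
Proof. by apply: bary_inj1; rewrite bary_seg1 clampK // bary_le1. Qed.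

Section Psing.
Variables (x y : X) (p : {path I from x to y}).
Lemma psing_subproof : continuous (fun t : Delta R 1 => p (clamp (bary t 1))).
Proof.
apply: continuous_comp_fun _ (@cts_fun _ _ p); apply: continuous_clamp_fun.
exact: bary_continuous.
Qed.
Definition psing : sing R X 1 := mkcts psing_subproof.

Lemma psingE t : sfun psing t = p (clamp (bary t 1)). Proof. by []. Qed.
Lemma psing_seg t : sfun psing (seg t) = p t.
Proof. by rewrite psingE bary_seg1 ivalK. Qed.
End Psing.

Lemma loop_singE (x0 : X) (p : loop R x0) : loop_sing p = psing p.
Proof. by apply: sing_eqP. Qed.

Lemma sing_path_subproof (s : sing R X 1) : continuous (fun t => sfun s (seg t)).
Proof. exact: continuous_comp_fun seg_continuous (@cts_fun _ _ s). Qed.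

Definition sing_path (s : sing R X 1) :
    {path I from sfun s (seg zero) to sfun s (seg one)} :=
  mk_path (@sing_path_subproof s) erefl erefl.

Lemma sing_pathK (s : sing R X 1) : psing (sing_path s) = s.
Proof. by apply: sing_eqP => t; rewrite psingE /= /mk_path seg_clamp. Qed.

Definition pt0 : Delta R 0 := push (fun=> ord0) (seg zero).
Definition sing_pt (s : sing R X 0) : X := sfun s pt0.

Lemma pt0_unique t : t = pt0.
Proof.
apply: bary_inj => -[|//] _.
have E (u : Delta R 0) : bary u 0 = 1 :> R.
  by rewrite -(bary_sum u) big_ord_recl big_ord0 addr0.
by rewrite !E.
Qed.

Lemma bary_vertex (i : 'I_2) t : bary (push (lift i) t : Delta R 1) 1 =
  if i == 0 then 1 else 0.
Proof.
rewrite (pt0_unique t) bary_push // big_mkcond big_ord_recl big_ord0 /= addr0.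
have -> : bary pt0 (ord0 : 'I_1) = 1 :> R.
  by rewrite -(bary_sum pt0) big_ord_recl big_ord0 addr0.
by case: i => -[|[|//]] hi.
Qed.

Lemma sing_pt_face0 (s : sing R X 1) : sing_pt (face 0 s) = sfun s (seg one).
Proof.
rewrite /sing_pt /face smapE; congr (sfun s _); apply: bary_inj1.
by rewrite bary_vertex bary_seg1 ival1.
Qed.

Lemma sing_pt_face1 (s : sing R X 1) : sing_pt (face 1 s) = sfun s (seg zero).
Proof.
rewrite /sing_pt /face smapE; congr (sfun s _); apply: bary_inj1.
by rewrite bary_vertex bary_seg1 ival0.
Qed.

Lemma frontE (s : sing R X 2) : front 1 s = face 2 s.
Proof.
rewrite /face /front; congr smap; apply/funext => i; apply: val_inj => /=.
by rewrite inordK //; case: i => -[|[]].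
Qed.

Lemma backE (s : sing R X 2) : back 1 s = face 0 s.
Proof.
rewrite /face /back; congr smap; apply/funext => i; apply: val_inj => /=.
by rewrite inordK //; case: i => -[|[]].
Qed.

Lemma bnd2 (s : sing R X 2) : bnd (<< s >> : chain R X 2) =
  << face 0 s >> - << face 1 s >> + << face 2 s >> :> chain R X 1.
Proof.
rewrite bnd_gen !big_ord_recl big_ord0 addr0 expr0 scale1r expr1 scaleN1r.
rewrite exprS expr1 mulrNN mulr1 scale1r addrA.
by congr (_ - << face _ s >> + << face _ s >>); apply: val_inj.
Qed.

Lemma cobd1 (phi : cochain R X 1) s :
  cobd phi s = phi (face 0 s) - phi (face 1 s) + phi (face 2 s).
Proof. by rewrite -ev_gen -ev_bnd bnd2 raddfD raddfB /= !ev_gen. Qed.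

Lemma cobd0 (f : cochain R X 0) s : cobd f s = f (face 0 s) - f (face 1 s).
Proof.
rewrite /cobd !big_ord_recl big_ord0 addr0 expr0 mul1r expr1 mulN1r.
by congr (_ - f (face _ s)); apply: val_inj.
Qed.

Lemma cocycle1 (phi : cochain R X 1) s : cobd phi = 0 ->
  phi (face 1 s) = phi (face 2 s) + phi (face 0 s).
Proof.
move=> /(congr1 (fun f => f s)); rewrite cobd1 => E.
have {}E : phi (face 0 s) - phi (face 1 s) + phi (face 2 s) = 0 by [].
lia.
Qed.

Lemma sfun_face (s : sing R X 2) i t : sfun (face i s) t = sfun s (face_pt i t).
Proof. by []. Qed.

Lemma mk_sing2 (F : Delta R 2 -> X) : continuous F ->
  exists s : sing R X 2, sfun s = F.
Proof. by move=> cF; exists (mkcts cF). Qed.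

Lemma const_simplex x : exists s : sing R X 2,
  forall i, face i s = psing (path_const R x).
Proof.
have [s sE] := mk_sing2 (@continuous_cst_fun (Delta R 2) X x).
by exists s => i; apply: sing_eqP => t; rewrite sfun_face sE.
Qed.

Lemma cocycle_const (phi : cochain R X 1) x : cobd phi = 0 ->
  phi (psing (path_const R x)) = 0.
Proof.
move=> phi0; have [s sE] := const_simplex x.
have := cocycle1 s phi0; rewrite !sE => E.
by apply: (@addrI _ (phi (psing (path_const R x)))); rewrite -E addr0.
Qed.

(** The 2-simplex folded onto the path p q along the linear map that sends its
    vertices to 0, 1/2 and 1. *)
Lemma concat_simplex x y z (p : {path I from x to y}) (q : {path I from y to z}) :
  exists s : sing R X 2, [/\ face 2 s = psing p, face 0 s = psing q &
    face 1 s = psing (path_concat p q)].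
Proof.
have [|s sE] := mk_sing2 (F := fun t => path_concat p q (clamp (bary t 2 + 2^-1 * bary t 1))).
  apply: continuous_comp_fun _ (@cts_fun _ _ (path_concat p q)).
  apply/continuous_clamp_fun/continuousD_fun; first exact: bary_continuous.
  by apply/continuousM_fun/bary_continuous; exact: continuous_cst_fun.
exists s; split; apply: sing_eqP => t; rewrite sfun_face sE psingE !bary_face //=.
all: have := bary_ge0 t 0; have := bary_ge0 t 1; have := bary_sum1 t; set u := bary t 1;
  set v := bary t 0 => uv u0 v0.
- rewrite add0r /mk_path /concat_fun clampK; last by apply/andP; split; lra.
  by rewrite ifT; [congr (p (clamp _)); lra|lra].
- rewrite /mk_path /concat_fun clampK; last by apply/andP; split; lra.
  case: lerP => h.
    have v1 : v = 1 by lra.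
    rewrite clamp_ge1 ?path_one; last by lra.
    by rewrite clamp_le0 ?path_zero //; lra.
  by congr (q (clamp _)); lra.
- by rewrite mulr0 addr0.
Qed.

(** The square of the homotopy cut along its diagonal into A and B. The two
    vertical sides are constant, and constant 2-simplices account for them; each
    cup product has a factor at such a side, so it vanishes. *)
Lemma homotopy_chain x y (p q : {path I from x to y}) : path_homotopic p q ->
  exists C : chain R X 2, bnd C = << psing p >> - << psing q >> :> chain R X 1 /\
  forall phi psi : cochain R X 1, cobd phi = 0 -> cobd psi = 0 ->
    ev (cupc phi psi : cochain R X 2) C = 0.
Proof.
move=> [H [cH H0 H1 Hx Hy]].
have cb i : continuous (fun t : Delta R 2 => bary t i) by exact: bary_continuous.
have [|A AE] := mk_sing2 (F := fun t => H (clamp (bary t 1 + bary t 2), clamp (bary t 2))).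
  by apply: continuous_comp_fun _ cH; apply: continuous_pair;
    apply: continuous_clamp_fun => //; exact: continuousD_fun.
have [|B BE] := mk_sing2 (F := fun t => H (clamp (bary t 2), clamp (bary t 1 + bary t 2))).
  by apply: continuous_comp_fun _ cH; apply: continuous_pair;
    apply: continuous_clamp_fun => //; exact: continuousD_fun.
have [Sx SxE] := const_simplex x; have [Sy SyE] := const_simplex y.
have A2 : face 2 A = psing p.
  apply: sing_eqP => t; rewrite sfun_face AE psingE !bary_face //= addr0 -zeroE.
  exact: H0.
have A0 : face 0 A = psing (path_const R y).
  apply: sing_eqP => t; rewrite sfun_face AE psingE !bary_face //= bary_sum1 -oneE.
  exact: Hy.
have B2 : face 2 B = psing (path_const R x).
  apply: sing_eqP => t; rewrite sfun_face BE psingE !bary_face //= -zeroE ?Hx.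
have B0 : face 0 B = psing q.
  apply: sing_eqP => t; rewrite sfun_face BE psingE !bary_face //= bary_sum1 -oneE.
  exact: H1.
have AB : face 1 A = face 1 B.
  by apply: sing_eqP => t; rewrite !sfun_face AE BE !bary_face //= add0r.
exists (<< A >> - << B >> + (<< Sx >> - << Sy >>)); split.
  rewrite raddfD !raddfB /= !bnd2 !SxE !SyE A2 A0 B2 B0 AB.
  set a := << psing p >>; set b := << psing q >>; set cx := << psing (path_const R x) >>.
  set cy := << psing (path_const R y) >>; set d := << face 1 B >>.
  rewrite (subrr cx) (subrr cy) !add0r opprD opprB.
  by rewrite [LHS](AC (3*3*2) ((3*5)*(1*8)*(4*2)*(7*6))) /= !subrr !addr0.
move=> phi psi phi0 psi0.
rewrite raddfD !raddfB /= !ev_gen /cupc !frontE !backE SxE SyE A0 B2.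
by rewrite !(cocycle_const _ phi0) !(cocycle_const _ psi0) !mul0r !mulr0.
Qed.

(** The relation of the bar construction, up to homotopy, with the value of cup
    products on the chain that realizes it. *)
Lemma concat_chain x y z (p : {path I from x to y}) (q : {path I from y to z})
    (r : {path I from x to z}) : path_homotopic (path_concat p q) r ->
  exists C : chain R X 2,
    bnd C = << psing p >> + << psing q >> - << psing r >> :> chain R X 1 /\
  forall phi psi : cochain R X 1, cobd phi = 0 -> cobd psi = 0 ->
    ev (cupc phi psi : cochain R X 2) C = phi (psing p) * psi (psing q).
Proof.
move=> /homotopy_chain[C [bC evC]]; have [s [s2 s0 s1]] := concat_simplex p q.
exists (<< s >> + C); split.
  rewrite raddfD /= bnd2 s2 s0 s1 bC.
  rewrite [LHS](AC (3*2) ((3*1)*5*(2*4))) /= addNr addr0 //.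
move=> phi psi phi0 psi0; rewrite raddfD /= ev_gen evC // addr0.
by rewrite /cupc frontE backE s2 s0.
Qed.

(** In the 2-simplex, the path along the edges 01 and 12 and the path along the
    edge 02 are joined by the linear homotopy. *)
Lemma simplex_homotopy (s : sing R X 2) : exists x y z
    (p : {path I from x to y}) (q : {path I from y to z}) (r : {path I from x to z}),
  [/\ path_homotopic (path_concat p q) r,
      psing p = face 2 s, psing q = face 0 s & psing r = face 1 s].
Proof.
pose e (i : 'I_3) (t : I) := sfun s (face_pt i (seg t)).
have ce i : continuous (e i) by exact: sing_path_subproof (face i s).
have e01 : e 2 one = e 0 zero.
  by congr (sfun s _); apply: bary_inj2;
    rewrite !bary_face //= ?bary_seg0 ?bary_seg1 ?ival1 ?ival0 ?subrr.
have e10 : e 1 zero = e 2 zero.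
  by congr (sfun s _); apply: bary_inj2;
    rewrite !bary_face //= ?bary_seg0 ?bary_seg1 ?ival1 ?ival0 ?subrr.
have e11 : e 1 one = e 0 one.
  by congr (sfun s _); apply: bary_inj2;
    rewrite !bary_face //= ?bary_seg0 ?bary_seg1 ?ival1 ?ival0 ?subrr.
exists (e 2 zero), (e 2 one), (e 0 one).
exists (mk_path (ce 2) erefl erefl), (mk_path (ce 0) (esym e01) erefl),
   (mk_path (ce 1) e10 e11).
have pE i (x y : X) (h0 : e i zero = x) (h1 : e i one = y) :
    psing (mk_path (ce i) h0 h1) = face i s.
  by apply: sing_eqP => t; rewrite psingE /= /mk_path /e seg_clamp.
split; rewrite ?pE //.
(* c and d are the barycentric coordinates of the two paths. *)
pose c0 (t : I) : R := Num.max 0 (1 - 2 * ival t).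
pose c2 (t : I) : R := Num.max 0 (2 * ival t - 1).
pose c i t := if i == 0%N then c0 t else if i == 1%N then 1 - c0 t - c2 t else c2 t.
pose d i (t : I) : R := if i == 0%N then 1 - ival t else if i == 1%N then 0 else ival t.
have cc0 : continuous c0.
  apply: continuous_max_fun; first exact: continuous_cst_fun.
  apply: continuousB_fun; first exact: continuous_cst_fun.
  by apply/continuousM_fun/continuous_ival_fun; exact: continuous_cst_fun.
have cc2 : continuous c2.
  apply: continuous_max_fun; first exact: continuous_cst_fun.
  apply: continuousB_fun; last exact: continuous_cst_fun.
  by apply/continuousM_fun/continuous_ival_fun; exact: continuous_cst_fun.
have cc i : continuous (c i).
  rewrite /c; case: i => [|[|i]] //=.
  by apply: continuousB_fun => //; apply: continuousB_fun => //; exact: continuous_cst_fun.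
have cd i : continuous (d i).
  rewrite /d; case: i => [|[|i]] /=; last exact: continuous_ival_fun.
    by apply: continuousB_fun; [exact: continuous_cst_fun|exact: continuous_ival_fun].
  exact: continuous_cst_fun.
have c_ge0 i t : 0 <= c i t.
  clear e01 e10 e11; rewrite /c /c0 /c2; have t0 := ival_ge0 t; have t1 := ival_le1 t.
  case: i => [|[|i]] /=; rewrite ?le_max ?lexx //.
  by case: (lerP 0 (1 - 2 * ival t)) => ?; case: (lerP 0 (2 * ival t - 1)) => ?; lra.
have d_ge0 i t : 0 <= d i t.
  clear e01 e10 e11; rewrite /d; have t0 := ival_ge0 t; have t1 := ival_le1 t.
  by case: i => [|[|i]] /=; lra.
have [||i _|F cF FE] := @simplex_family R (I * I)%type 2
    (fun i u => (1 - ival u.2) * c i u.1 + ival u.2 * d i u.1).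
- move=> i [t u] _ /=; apply: addr_ge0; apply: mulr_ge0 => //; last exact: ival_ge0.
  by rewrite subr_ge0 ival_le1.
- move=> [t u]; rewrite !big_ord_recl big_ord0 /= /c /d /=; ring.
- have cs : continuous (fun u : I * I => ival u.2).
    exact: continuous_comp_fun (@continuous_snd I I) (@continuous_ival_fun R).
  apply: continuousD_fun; apply: continuousM_fun => //.
  + by apply: continuousB_fun => //; exact: continuous_cst_fun.
  + exact: (@continuous_comp_fun _ _ _ fst (c i)) (@continuous_fst I I) (cc i).
  + exact: (@continuous_comp_fun _ _ _ fst (d i)) (@continuous_fst I I) (cd i).
exists (fun u => sfun s (F u)); split.
- exact: continuous_comp_fun cF (@cts_fun _ _ s).
- move=> t; have t0 := ival_ge0 t; have t1 := ival_le1 t.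
  rewrite /= /mk_path /concat_fun; case: lerP => h; rewrite /e; congr (sfun s _); apply: bary_inj2;
  rewrite FE // bary_face //= /c /= /c0 /c2 ?bary_seg0 ?bary_seg1 ival0 mul0r addr0 subr0 mul1r
    ?clampK; clear -t0 t1 h; by [apply/andP; split; lra|case: lerP => ?; lra].
- move=> t; rewrite /= /mk_path /e; congr (sfun s _); apply: bary_inj2;
  by rewrite FE // bary_face //= /d /= ?bary_seg0 ?bary_seg1 ival1 subrr mul0r add0r mul1r.
- move=> u; rewrite /= /e; congr (sfun s _); apply: bary_inj2;
  rewrite FE // bary_face //= /c /d /= /c0 /c2 ?bary_seg0 ?bary_seg1 ival0;
  by clear; case: lerP => ?; lra.
- move=> u; rewrite /= /e; congr (sfun s _); apply: bary_inj2;
  rewrite FE // bary_face //= /c /d /= /c0 /c2 ?bary_seg0 ?bary_seg1 ival1;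
  by clear; case: lerP => ?; lra.
Qed.
End PathSimplices.

(** * The class of a singular 1-simplex in the fundamental group *)

Section PathClass.
Variables (R : realType) (X : topologicalType) (x0 : X).
Local Notation I := (I01 R).
Variable gamma : forall x : X, {path I from x0 to x}.
Local Notation G := (pi1 R x0).
Local Open Scope group_scope.

Lemma pi1_piM (p q : loop R x0) :
  \pi_G (path_concat p q : loop R x0) = \pi_G p * \pi_G q.
Proof. exact: esym (pi1_mulE p q). Qed.

Lemma pi1_piV (p : loop R x0) :
  \pi_G (path_inverse p : loop R x0) = (\pi_G p)^-1.
Proof. exact: esym (pi1_invE p). Qed.

Lemma pi1_pi_eq (p q : loop R x0) : path_homotopic p q -> \pi_G p = \pi_G q.
Proof. by move=> pq; apply/pi1P/asboolP. Qed.

Definition tailed_loop x y (p : {path I from x to y}) : loop R x0 :=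
  path_concat (path_concat (gamma x) p) (path_inverse (gamma y)).

Definition base_loop : G := \pi_G (gamma x0 : loop R x0).

(** The conjugation by the loop chosen at the base point makes a loop its own
    representative, see path_class_loop. *)
Definition path_class x y (p : {path I from x to y}) : G :=
  base_loop^-1 * \pi_G (tailed_loop p) * base_loop.

Lemma path_class_homotopic x y (p q : {path I from x to y}) :
  path_homotopic p q -> path_class p = path_class q.
Proof.
move=> pq; congr (_ * _ * _); apply: pi1_pi_eq.
apply: path_concat_homotopic; last exact: path_homotopic_refl.
by apply: path_concat_homotopic => //; exact: path_homotopic_refl.
Qed.

Lemma path_class_concat x y z (p : {path I from x to y}) (q : {path I from y to z}) :
  path_class (path_concat p q) = path_class p * path_class q.
Proof.
have -> : path_class p * path_class q =
    base_loop^-1 * (\pi_G (tailed_loop p) * \pi_G (tailed_loop q)) * base_loop.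
  by rewrite /path_class !mulgA mulgK.
congr (_ * _ * _); rewrite -pi1_piM; apply: pi1_pi_eq.
apply: path_homotopic_sym.
apply: path_homotopic_trans (path_concatA _ _ _) _.
apply: path_concat_homotopic; last exact: path_homotopic_refl.
apply: path_homotopic_trans (path_concatA _ _ _) _.
apply: path_homotopic_trans (path_homotopic_sym (path_concatA _ _ _)).
apply: path_concat_homotopic; last exact: path_homotopic_refl.
apply: path_homotopic_trans (path_homotopic_sym (path_concatA _ _ _)) _.
apply: path_homotopic_trans (path_concat1 _).
apply: path_concat_homotopic; first exact: path_homotopic_refl.
exact: path_Vconcat.
Qed.

Lemma path_class_loop (p : loop R x0) : path_class p = \pi_G p.
Proof.
rewrite /path_class /tailed_loop (pi1_piM (path_concat _ _)) pi1_piM pi1_piV.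
by rewrite -/base_loop !mulgA mulgVK mulVg mul1g.
Qed.

Definition sing_class (s : sing R X 1) : G := path_class (sing_path s).

(** For end points that are equal without being convertible, as those of
    consecutive faces of a simplex. *)
Lemma path_class_ext x y x' y' (p : {path I from x to y}) (q : {path I from x' to y'}) :
  x = x' -> y = y' -> p =1 q -> path_class p = path_class q.
Proof. by move=> ex ey; case: x' / ex q; case: y' / ey => q /path_eqP ->. Qed.

Lemma sing_class_psing x y (p : {path I from x to y}) :
  sing_class (psing p) = path_class p.
Proof.
apply: path_class_ext => [||t]; rewrite ?psing_seg ?path_zero ?path_one //.
exact: psing_seg.
Qed.

Lemma sing_class_simplex (s : sing R X 2) :
  sing_class (face 1%R s) = sing_class (face 2%R s) * sing_class (face 0%R s).
Proof.
have [x [y [z [p [q [r [pqr <- <- <-]]]]]]] := simplex_homotopy s.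
by rewrite !sing_class_psing -path_class_concat (path_class_homotopic pqr).
Qed.

Lemma sing_class_loop (g : G) : sing_class (loop_sing (repr g)) = g.
Proof. by rewrite loop_singE sing_class_psing path_class_loop reprK. Qed.

End PathClass.

(** * Chains and cocycles with values in an abelian group *)

Section Chains.
Variables (R : realType) (X : topologicalType).
Local Notation I := (I01 R).

Lemma chain_ind n (P : chain R X n -> Prop) : P 0 ->
  (forall c d, P c -> P d -> P (c - d)) -> (forall s, P << s >>) -> forall c, P c.
Proof.
move=> P0 PB Ps c.
have PN d : P d -> P (- d) by rewrite -sub0r; exact: PB.
have PD d e : P d -> P e -> P (d + e) by move=> Pd /PN; rewrite -{2}[e]opprK; exact: PB.
have PM d k : P d -> P (d *+ k).
  by move=> Pd; elim: k => [|k IH]; rewrite ?mulr0n // mulrS; exact: PD.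
rewrite -(freeg_sumE c); elim: (dom c) => [|s l IH]; first by rewrite big_nil.
rewrite big_cons; apply: PD => //.
rewrite -[coeff s c]intz -freegU_mulz; case: (coeff s c) => k /=; first exact: PM.
by apply: PN; exact: PM.
Qed.

(** Linear extension of f; zmodule A is A as a module over the integers. *)
Definition zlift n (A : zmodType) (f : sing R X n -> A) (c : chain R X n) : A :=
  fglift (f : sing R X n -> zmodule A) c.

Lemma zlift_is_zmod_morphism n (A : zmodType) (f : sing R X n -> A) :
  zmod_morphism (zlift f).
Proof. exact (@lift_is_additive int (sing R X n) (zmodule A) _). Qed.
HB.instance Definition _ n (A : zmodType) (f : sing R X n -> A) :=
  GRing.isZmodMorphism.Build (chain R X n) A (zlift f) (zlift_is_zmod_morphism f).

Lemma zlift_gen n (A : zmodType) (f : sing R X n -> A) s :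
  zlift f << s >> = f s.
Proof. by rewrite /zlift liftU scale1r. Qed.

Lemma bnd1 (s : sing R X 1) : bnd (<< s >> : chain R X 1) =
  << face 0 s >> - << face 1 s >> :> chain R X 0.
Proof.
rewrite bnd_gen !big_ord_recl big_ord0 addr0 expr0 scale1r expr1 scaleN1r.
by congr (_ - << face _ s >>); apply: val_inj.
Qed.

(** The coefficient group A is arbitrary: besides integral cocycles, the cases
    needed are chains modulo boundaries and the abelianized fundamental group. *)
Section Cocycle.
Variables (A : zmodType) (f : sing R X 1 -> A).
Hypothesis fP : forall s : sing R X 2, f (face 1 s) = f (face 2 s) + f (face 0 s).

Lemma cocycle_bnd C : zlift f (bnd C) = 0.
Proof.
elim/chain_ind: C => [|c d fc fd|s]; rewrite ?raddf0 // ?raddfB /= ?fc ?fd ?subrr //.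
by rewrite bnd2 raddfD raddfB /= !zlift_gen fP [f (face 2 s) + _]addrC
  opprD addrA subrr sub0r addNr.
Qed.

Lemma cocycle_homotopic x y (p q : {path I from x to y}) :
  path_homotopic p q -> f (psing p) = f (psing q).
Proof.
move=> /homotopy_chain[C [bC _]]; have := cocycle_bnd C.
by rewrite bC raddfB /= !zlift_gen => /eqP; rewrite subr_eq0 => /eqP.
Qed.

Lemma cocycle_path_concat x y z (p : {path I from x to y}) (q : {path I from y to z}) :
  f (psing (path_concat p q)) = f (psing p) + f (psing q).
Proof. by have [s [s2 s0 s1]] := concat_simplex p q; rewrite -s1 fP s2 s0. Qed.

Lemma cocycle_path_inverse x y (p : {path I from x to y}) :
  f (psing (path_inverse p)) = - f (psing p).
Proof.
have E0 : f (psing (path_const R y)) = 0.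
  have := cocycle_path_concat (path_const R y) (path_const R y).
  rewrite (cocycle_homotopic (path_concat1 _)) => E.
  by apply: (@addrI _ (f (psing (path_const R y)))); rewrite -E addr0.
apply: (@addIr _ (f (psing p))); rewrite -cocycle_path_concat addNr -E0.
exact/cocycle_homotopic/path_Vconcat.
Qed.

Variables (x0 : X) (gamma : forall x, {path I from x0 to x}).
Local Notation G := (pi1 R x0).

Definition cocycle_eval (g : G) : A := f (loop_sing (repr g)).

Lemma cocycle_eval_pi (p : loop R x0) : cocycle_eval (\pi_G p) = f (psing p).
Proof.
by rewrite /cocycle_eval loop_singE; apply: cocycle_homotopic; exact: repr_homotopic.
Qed.

Lemma cocycle_evalM (g h : G) :
  cocycle_eval (g * h)%g = cocycle_eval g + cocycle_eval h.
Proof.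
by rewrite -[g]reprK -[h]reprK -pi1_piM !cocycle_eval_pi cocycle_path_concat.
Qed.

Lemma cocycle_evalV (g : G) : cocycle_eval g^-1%g = - cocycle_eval g.
Proof.
by rewrite -[g]reprK -pi1_piV !cocycle_eval_pi cocycle_path_inverse.
Qed.

(** A 1-cocycle is cohomologous to one that factors through sing_class: the
    values on the paths gamma form the 0-cochain in between. *)
Lemma cocycle_sing_class s : cocycle_eval (sing_class gamma s) =
  f (psing (gamma (sing_pt (face 1 s)))) + f s
    - f (psing (gamma (sing_pt (face 0 s)))).
Proof.
rewrite /sing_class /path_class !cocycle_evalM cocycle_evalV addrAC addNr add0r.
rewrite cocycle_eval_pi !cocycle_path_concat cocycle_path_inverse sing_pathK.
by rewrite sing_pt_face0 sing_pt_face1.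
Qed.

End Cocycle.
End Chains.

(** * The Hurewicz map and H^1 as the dual of H_1 *)

Section HomologyClasses.
Variables (R : realType) (X : topologicalType).
Local Notation I := (I01 R).

Lemma hclass_eq n (z w : Defs.cycle R X n) :
  (exists C : chain R X n.+1, bnd C = val z - val w) -> hclass z = hclass w.
Proof.
by move=> [C bC]; apply/eqP; rewrite -Quotient.idealrBE; apply/asboolP; exists C.
Qed.

Definition boundary_chains n : {pred chain R X n} :=
  fun c => `[< exists C : chain R X n.+1, bnd C = c >].
Lemma boundary_chains_closed n : zmod_closed (@boundary_chains n).
Proof.
split=> [|c d /asboolP[C <-] /asboolP[D <-]]; apply/asboolP.
  by exists 0; rewrite raddf0.
by exists (C - D); rewrite raddfB.
Qed.
HB.instance Definition _ n :=
  GRing.isZmodClosed.Build (chain R X n) (@boundary_chains n) (@boundary_chains_closed n).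

(** Chains modulo boundaries; homology embeds in this group, and in it every
    singular simplex has a class. *)
Local Notation Q n := (Quotient.quot (@boundary_chains n)).

Definition class_mod_bnd n (h : homology R X n) : Q n := \pi_(Q n) (hrep h).

Lemma pi_bnd n (C : chain R X n.+1) : \pi_(Q n) (bnd C) = 0.
Proof.
have -> : (0 : Q n) = \pi_(Q n) 0 by rewrite raddf0.
by apply/eqP; rewrite -Quotient.idealrBE subr0; apply/asboolP; exists C.
Qed.

Lemma class_mod_bndD n (h k : homology R X n) :
  class_mod_bnd (h + k) = class_mod_bnd h + class_mod_bnd k.
Proof.
by rewrite /class_mod_bnd; have [C ->] := hrepD h k; rewrite !raddfD /= pi_bnd addr0.
Qed.

Lemma class_mod_bnd_class n (z : Defs.cycle R X n) :
  class_mod_bnd (hclass z) = \pi_(Q n) (val z).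
Proof.
by rewrite /class_mod_bnd; have [C ->] := hrep_class z; rewrite raddfD /= pi_bnd addr0.
Qed.

Lemma class_mod_bnd0 n : class_mod_bnd (0 : homology R X n) = 0.
Proof.
by apply: (@addIr _ (class_mod_bnd (0 : homology R X n))); rewrite -class_mod_bndD !add0r.
Qed.

Lemma class_mod_bnd_inj n : injective (@class_mod_bnd n).
Proof.
move=> h k hk.
have {hk} : hrep h - hrep k \in @boundary_chains n.
  by rewrite Quotient.idealrBE; apply/eqP.
move=> /asboolP[C bC].
rewrite -[h]reprK -[k]reprK; apply: (@hclass_eq n
  (repr (h : Quotient.quot (@boundaries R X n)))
  (repr (k : Quotient.quot (@boundaries R X n)))).
by exists C.
Qed.

Lemma class_mod_bnd_is_zmod_morphism n : zmod_morphism (@class_mod_bnd n).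
Proof.
move=> h k; apply: (@addIr _ (class_mod_bnd k)); by rewrite -class_mod_bndD !subrK.
Qed.
HB.instance Definition _ n :=
  GRing.isZmodMorphism.Build (homology R X n) (Q n) (@class_mod_bnd n)
    (@class_mod_bnd_is_zmod_morphism n).

(** The difference of the two sides is the boundary of s. *)
Lemma pi_sing_cocycle (s : sing R X 2) :
  \pi_(Q 1) << face 1 s >> = \pi_(Q 1) << face 2 s >> + \pi_(Q 1) << face 0 s >>.
Proof.
have := pi_bnd << s >>; rewrite bnd2 raddfD raddfB /= => E.
apply/esym/eqP; rewrite -subr_eq0; apply/eqP; rewrite -[RHS]E.
by rewrite [LHS](AC (2*1) ((2*3)*1)).
Qed.

Variables (x0 : X) (gamma : forall x, {path I from x0 to x}).
Local Notation G := (pi1 R x0).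

Lemma class_mod_bnd_hurewicz (g : G) :
  class_mod_bnd (hurewicz g) = cocycle_eval (fun s => \pi_(Q 1) << s >>) g.
Proof. exact: class_mod_bnd_class. Qed.

Lemma hurewiczM (g h : G) : hurewicz (g * h)%g = hurewicz g + hurewicz h.
Proof.
apply: class_mod_bnd_inj; rewrite class_mod_bndD !class_mod_bnd_hurewicz.
exact: (cocycle_evalM pi_sing_cocycle).
Qed.

(** By cocycle_sing_class, replacing each simplex by the loop through it changes a
    chain, modulo boundaries, by a term that depends on its boundary alone. *)
Lemma hclass_hurewicz (z : Defs.cycle R X 1) :
  hclass z = zlift (fun s => hurewicz (sing_class gamma s)) (val z).
Proof.
pose gam (s : sing R X 0) := \pi_(Q 1) << psing (gamma (sing_pt s)) >>.
pose F c := class_mod_bnd (zlift (fun s => hurewicz (sing_class gamma s)) c).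
have E c : F c = \pi_(Q 1) c - zlift gam (bnd c).
  elim/chain_ind: c => [|c d Fc Fd|s].
  - by rewrite /F !raddf0 ?addr0.
  - rewrite /F !raddfB /= -/(F c) -/(F d) Fc Fd /=.
    by rewrite opprD opprK [LHS](AC (2*2) ((1*3)*(2*4))) /=.
  - rewrite /F zlift_gen class_mod_bnd_hurewicz (cocycle_sing_class pi_sing_cocycle).
    by rewrite bnd1 raddfB /= !zlift_gen opprB [LHS](AC (2*1) (2*(1*3))).
apply: class_mod_bnd_inj; rewrite -/(F _) E class_mod_bnd_class.
have /asboolP /= -> := valP z.
by rewrite raddf0 subr0.
Qed.

Lemma hurewicz_surj (h : homology R X 1) : exists g : G, hurewicz g = h.
Proof.
rewrite -[h]reprK -/(hclass _) hclass_hurewicz; set c := val _.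
elim/chain_ind: c => [|c d [g gc] [k kd]|s].
- by exists 1%g; rewrite raddf0 (hom1 hurewiczM).
- by exists (g * k^-1)%g; rewrite hurewiczM (homV hurewiczM) gc kd raddfB.
- by exists (sing_class gamma s); rewrite zlift_gen.
Qed.

(** The class of simplices in the abelianized fundamental group is a cocycle, so
    it vanishes on boundaries. *)
Lemma hurewicz_kernel (g : G) : hurewicz g = 0 -> g \in derived G.
Proof.
move=> g0.
pose f s : zcenter (gquot (derived G)) := exist (fun z => z \in @gcenter _) _
  (derived_quotient_central (\pi_(gquot (derived G)) (sing_class gamma s))).
have fP s : f (face 1 s) = f (face 2 s) + f (face 0 s).
  by apply: val_inj; rewrite /= sing_class_simplex -gmulfM.
have : class_mod_bnd (hurewicz g) = 0 by rewrite g0 class_mod_bnd0.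
rewrite class_mod_bnd_class /= => /eqP.
have -> : (0 : Q 1) = \pi_(Q 1) 0 by rewrite raddf0.
rewrite -Quotient.idealrBE subr0 => /asboolP[C bC].
have := cocycle_bnd fP C; rewrite bC zlift_gen => /(congr1 val) /= fg.
by rewrite -pi_gquot1 -[g](sing_class_loop gamma) fg.
Qed.

Lemma kron_hurewicz (g : G) (a : cohomology R X 1) :
  kron (hurewicz g) a = cocycle_eval (crep a) g.
Proof.
rewrite /kron /hurewicz; set z := exist _ _ _; have [C ->] := hrep_class z.
by rewrite raddfD /= ev_bnd0 ?crepP // addr0 ev_gen.
Qed.

Lemma kron_hurewiczM (a : cohomology R X 1) (g h : G) :
  kron (hurewicz (g * h)%g) a = kron (hurewicz g) a + kron (hurewicz h) a.
Proof. by rewrite hurewiczM kronDl. Qed.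

Lemma hurewicz_torsion (g : G) n : (0 < n)%N -> hurewicz g *+ n = 0 -> Dtilde G g.
Proof.
move=> n0 gn; exists n; split=> //; rewrite -gmulfXn; apply/eqP.
by rewrite pi_gquot1; apply: hurewicz_kernel; rewrite (homX hurewiczM).
Qed.

(** A cocycle that vanishes on loops is the coboundary of its values on the paths
    gamma. *)
Lemma cohomology_eq0 (a : cohomology R X 1) :
  (forall g : G, kron (hurewicz g) a = 0) -> a = 0.
Proof.
move=> a0.
have -> : (0 : cohomology R X 1) = cclass 0 by rewrite /cclass raddf0.
rewrite -[a]reprK; apply/eqP.
rewrite -Quotient.idealrBE subr0; apply/asboolP => /=.
exists (fun s => crep a (psing (gamma (sing_pt s)))).
apply/funext => s; rewrite cobd0 -/(crep a).
have := cocycle_sing_class (fun s => cocycle1 s (crepP a)) gamma s.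
by rewrite -kron_hurewicz a0 => E; lia.
Qed.

(** The cocycle is the value of u on the homology class of the loop through a
    simplex. *)
Lemma cohomology_of_hom (u : homology R X 1 -> int) :
  (forall h k, u (h + k) = u h + u k) ->
  exists a : cohomology R X 1, forall h, kron h a = u h.
Proof.
move=> uD.
have u0 : u 0 = 0 by apply: (@addIr _ (u 0)); rewrite -uD !add0r.
have uB h k : u (h - k) = u h - u k.
  by apply: (@addIr _ (u k)); rewrite -uD !subrK.
pose phi : cochain R X 1 := fun s => u (hurewicz (sing_class gamma s)).
have phi0 : phi \in @cocycles R X 1.
  apply/eqP/funext => s; rewrite cobd1 /phi sing_class_simplex hurewiczM uD.
  by rewrite -[RHS]/0; lia.
exists (cclass (exist (fun f => f \in @cocycles R X 1) phi phi0)) => h.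
rewrite -[h]reprK -/(hclass _) kron_classes hclass_hurewicz.
have E c : ev phi c = u (zlift (fun s => hurewicz (sing_class gamma s)) c).
  elim/chain_ind: c => [|c d cE dE|s]; rewrite ?raddf0 ?u0 //.
    by rewrite !raddfB /= uB cE dE.
  by rewrite ev_gen zlift_gen.
exact: E.
Qed.
End HomologyClasses.

(** * Alternating forms of chains that bound a loop *)

Section Bounding.
Variables (R : realType) (X : topologicalType) (x0 : X).
Local Notation I := (I01 R).
Local Notation G := (pi1 R x0).
Local Notation Hc := (cohomology R X 1).
Local Notation L g := (<< loop_sing (repr (g : G)) >> : chain R X 1).
Local Notation v a g := (kron (hurewicz (g : G)) a).
Local Notation cupev a b C :=
  (ev (cupc (crep (a : Hc)) (crep (b : Hc)) : cochain R X 2) C).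

Lemma product_chain (g h : G) : exists C : chain R X 2,
  bnd C = L g + L h - L (g * h)%g /\
  forall a b : Hc, cupev a b C = v a g * v b h.
Proof.
have [|C [bC evC]] := @concat_chain _ _ _ _ _ (repr g) (repr h) (repr (g * h)%g).
  by apply: path_homotopic_sym; exact: repr_homotopic.
exists C; rewrite bC !loop_singE; split=> // a b.
rewrite evC ?crepP //.
by rewrite !kron_hurewicz /cocycle_eval !loop_singE.
Qed.

(** The graph of the isomorphism, before passing to quotients. The sign makes the
    commutator of g and h correspond to the wedge of g and h. *)
Definition bounding (d : G) (B : alt2 Hc) : Prop := exists C : chain R X 2,
  bnd C = L d /\ forall a b : Hc, cupev a b C = - val B a b.

Lemma bounding_kron d B : bounding d B -> forall a : Hc, v a d = 0.
Proof.
move=> [C [bC _]] a; rewrite kron_hurewicz /cocycle_eval -ev_gen -bC.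
by rewrite ev_bnd0 // crepP.
Qed.

Lemma boundingM d e B B' :
  bounding d B -> bounding e B' -> bounding (d * e)%g (B + B').
Proof.
move=> dB eB; have [C [bC evC]] := dB; have [C' [bC' evC']] := eB.
have [E [bE evE]] := product_chain d e.
exists (C + C' - E); split.
  by rewrite raddfB raddfD /= bC bC' bE opprB addrCA subrr addr0.
move=> a b; rewrite raddfB raddfD /= evC evC' evE (bounding_kron dB) mul0r subr0.
exact: esym (opprD _ _).
Qed.

Lemma bounding1 : bounding 1%g 0.
Proof.
have [E [bE evE]] := product_chain 1%g 1%g.
exists E; split; first by rewrite bE mulg1 addrK.
move=> a b; rewrite evE.
have -> : v a 1%g = 0 by exact: (hom1 (f := fun g : G => v a g) (kron_hurewiczM a)).
by rewrite mul0r -[RHS]/(- 0) oppr0.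
Qed.

Lemma boundingV d B : bounding d B -> bounding d^-1%g (- B).
Proof.
move=> dB; have [C [bC evC]] := dB.
have [E [bE evE]] := product_chain d d^-1%g.
have [E1 [bE1 evE1]] := bounding1.
exists (E + E1 - C); split.
  by rewrite raddfB raddfD /= bC bE bE1 mulgV subrK addrAC subrr add0r.
move=> a b; rewrite raddfB raddfD /= evC evE (bounding_kron dB) mul0r add0r.
rewrite evE1 -[LHS]/(- 0 - - val B a b) -[RHS]/(- - val B a b).
by rewrite oppr0 add0r.
Qed.

(** With c the commutator of g and h, the products c (h g) = g h, h g and g h give
    three chains, and C_(c, h g) + C_(h, g) - C_(g, h) has boundary c. *)
Lemma bounding_commutator g h :
  bounding (g * h * g^-1 * h^-1)%g (wedge_form (hurewicz g) (hurewicz h)).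
Proof.
set c := (g * h * g^-1 * h^-1)%g.
have vc (a : Hc) : v a c = 0.
  apply: (hom_derived (f := fun x : G => v a x) (kron_hurewiczM a)).
  by apply: generated_ge; exists g, h.
have [C [bC evC]] := product_chain c (h * g)%g.
have [E [bE evE]] := product_chain h g.
have [F [bF evF]] := product_chain g h.
have cE : (c * (h * g) = g * h)%g by rewrite /c !mulgA !mulgVK.
exists (C + E - F); split.
  rewrite raddfB raddfD /= bC bE bF cE.
  rewrite opprB opprD.
  rewrite [LHS](AC (3*3*(1*2)) (1*(2*6)*(7*3)*(4*9)*(5*8))) /=.
  by rewrite !subrr !addr0.
move=> a b; rewrite raddfB raddfD /= evC evE evF vc mul0r add0r.
by rewrite /=; ring.
Qed.

Lemma derived_bounding d : d \in derived G -> exists B, bounding d B.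
Proof.
move: d; apply: generated_ind => [|d e [B dB] [B' eB]|d [B dB]|_ [g [h [_ _ ->]]]].
- by exists 0; exact: bounding1.
- by exists (B + B'); exact: boundingM.
- by exists (- B); exact: boundingV.
- by exists (wedge_form (hurewicz g) (hurewicz h)); exact: bounding_commutator.
Qed.

Lemma Dtilde_kron g (a : Hc) : Dtilde G g -> v a g = 0.
Proof.
move=> [n [n0 gn]].
have : (g ^+ n)%g \in derived G.
  by rewrite -pi_gquot1 gmulfXn; apply/eqP.
move=> /(hom_derived (f := fun x : G => v a x) (kron_hurewiczM a)).
rewrite (homX (f := fun x : G => v a x) (kron_hurewiczM a)) => /eqP.
by rewrite Num.Theory.mulrn_eq0 -leqn0 leqNgt n0 => /eqP.
Qed.

(** The wedge with a torsion class is the zero form on H^1. *)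
Lemma commDtilde_null d : d \in commDtilde G -> bounding d 0.
Proof.
move: d; apply: generated_ind => [|d e d0 e0|d d0|_ [g [h [Dg _ ->]]]].
- exact: bounding1.
- by rewrite -[0]addr0; exact: boundingM.
- by rewrite -oppr0; exact: boundingV.
have <- : wedge_form (hurewicz g) (hurewicz h) = 0; last exact: bounding_commutator.
apply: val_inj; apply/funext => a; apply/funext => b.
by rewrite /= !(Dtilde_kron _ Dg) mul0r mulr0 subr0.
Qed.

Lemma coker_mu_eq (B B' : alt2 Hc) :
  coker_mu_class B = coker_mu_class B' <-> exists s, mu s = B - B'.
Proof.
split=> [|[s sB]].
  by move=> /eqP; rewrite -Quotient.idealrBE => /asboolP.
by apply/eqP; rewrite -Quotient.idealrBE; apply/asboolP; exists s.
Qed.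

(** Two chains with the same boundary differ by a cycle. *)
Lemma bounding_unique d B B' : bounding d B -> bounding d B' ->
  coker_mu_class B = coker_mu_class B'.
Proof.
move=> [C [bC evC]] [C' [bC' evC']].
have z0 : C' - C \in @cycles R X 2.
  by apply/asboolP; rewrite /= raddfB /= bC bC' subrr.
apply/coker_mu_eq; exists (hclass (exist (fun c => c \in @cycles R X 2) _ z0)).
apply: val_inj; apply/funext => a; apply/funext => b.
transitivity (cupev a b (C' - C)); first exact: kron_classes.
rewrite raddfB /= evC evC' opprK addrC.
by [].
Qed.

End Bounding.

(** * Injectivity *)

Section Injectivity.
Variables (R : realType) (X : topologicalType) (x0 : X).
Variable gamma : forall x : X, {path I01 R from x0 to x}.
Local Notation I := (I01 R).
Local Notation G := (pi1 R x0).
Local Notation N := (commDtilde G).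
Local Notation Hc := (cohomology R X 1).
Local Notation L g := (<< loop_sing (repr (g : G)) >> : chain R X 1).
Local Notation v a g := (kron (hurewicz (g : G)) a).
Local Notation cupev a b C :=
  (ev (cupc (crep (a : Hc)) (crep (b : Hc)) : cochain R X 2) C).
Variables (r : nat) (h : 'I_r -> G) (al : 'I_r -> Hc).
Hypothesis alh : forall i j, v (al i) (h j) = (i == j)%:R.
Hypothesis al_torsion : forall g : G, (forall i, v (al i) g = 0) -> Dtilde G g.

Definition coord (i : 'I_r) (e : gquot N) : int := v (al i) (repr e).

Lemma coord_pi i (g : G) : coord i (\pi_(gquot N) g) = v (al i) g.
Proof.
rewrite /coord; set g' := repr _.
have : (g'^-1 * g)%g \in N by apply/gequivP; rewrite reprK.
move=> /commDtilde_derived /(hom_derived (f := fun x : G => v (al i) x) (kron_hurewiczM _)).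
rewrite kron_hurewiczM (homV (f := fun x : G => v (al i) x) (kron_hurewiczM _)) addrC => /eqP.
by rewrite subr_eq0 => /eqP.
Qed.

Lemma coordM i x y : coord i (x * y)%g = coord i x + coord i y.
Proof. by rewrite -[x]reprK -[y]reprK -gmulfM !coord_pi kron_hurewiczM. Qed.

Lemma coord_h i j : coord i (\pi_(gquot N) (h j)) = (i == j)%:R.
Proof. by rewrite coord_pi alh. Qed.

(** A commutator with an element of D~ is trivial in the quotient. *)
Lemma coord_central x : (forall i, coord i x = 0) -> x \in @gcenter (gquot N).
Proof.
move=> cx0; apply/gcenterP => y; rewrite -[x]reprK -[y]reprK -!gmulfM.
apply/esym/gequivP; apply: generated_ge; exists (repr x)^-1%g, (repr y)^-1%g.
split=> //; last by rewrite !invgK invgM !mulgA.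
apply: al_torsion => i.
by rewrite (homV (f := fun x : G => v (al i) x) (kron_hurewiczM _))
  -[X in - X]/(coord i x) cx0 oppr0.
Qed.

Local Notation central := (central_part coordM coord_h coord_central).
Local Notation sc := (sing_class gamma).

(** The cocycle cohomologous to crep a that factors through sing_class. *)
Definition class_cochain (a : Hc) : cochain R X 1 := fun s => v a (sc s).

Lemma back_id (s : sing R X 1) : back 1 s = s.
Proof.
apply: sing_eqP => t; rewrite /back smapE; congr (sfun s _).
apply: bary_inj1; rewrite bary_push // big_mkcond !big_ord_recl big_ord0 /=.
by rewrite !inordK //= add0r addr0.
Qed.

Lemma front_id (s : sing R X 1) : front 1 s = s.
Proof.
apply: sing_eqP => t; rewrite /front smapE; congr (sfun s _).
apply: bary_inj1; rewrite bary_push // big_mkcond !big_ord_recl big_ord0 /=.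
by rewrite !inordK //= add0r addr0.
Qed.

(** Replacing a and b by cohomologous cocycles changes their cup product by the
    coboundary of terms that vanish on d, by the Leibniz rule. *)
Lemma class_cochain_cup (d : G) (C : chain R X 2) (a b : Hc) :
  (forall c : Hc, v c d = 0) -> bnd C = L d ->
  ev (cupc (class_cochain a) (class_cochain b) : cochain R X 2) C = cupev a b C.
Proof.
move=> vd bC.
pose F (c : Hc) : cochain R X 0 := fun s => crep c (psing (gamma (sing_pt s))).
have nE c : class_cochain c = crep c - cobd (F c).
  apply/funext => s; rewrite /class_cochain kron_hurewicz.
  rewrite (cocycle_sing_class (fun s => cocycle1 s (crepP c))).
  rewrite -[RHS]/(crep c s - cobd (F c) s) cobd0 /F.
  by ring.
have n0 c : cobd (class_cochain c) = 0.
  apply/funext => s; rewrite cobd1 /class_cochain sing_class_simplex kron_hurewiczM -[RHS]/0.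
  by ring.
have E1 : ev (cobd (cupc (F a) (crep b)) : cochain R X 2) C = 0.
  rewrite -ev_bnd bC ev_gen /cupc back_id.
  by rewrite -[crep b _]/(cocycle_eval (crep b) d) -kron_hurewicz vd mulr0.
have E2 : ev (cobd (cupc (class_cochain a) (F b)) : cochain R X 2) C = 0.
  rewrite -ev_bnd bC ev_gen /cupc front_id.
  by rewrite /class_cochain sing_class_loop vd mul0r.
have -> : cupc (class_cochain a) (class_cochain b) =
   cupc (crep a) (crep b) +
   (cobd (cupc (class_cochain a) (F b)) - cobd (cupc (F a) (crep b))) :> cochain R X 2.
  apply/funext => s.
  rewrite -[RHS]/(cupc (crep a) (crep b) s +
    (cobd (cupc (class_cochain a) (F b)) s - cobd (cupc (F a) (crep b)) s)).
  rewrite !leibniz n0 crepP /cupc.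
  have z k (t : sing R X k) : (0 : cochain R X k) t = 0 by [].
  have nEs c t : class_cochain c t = crep c t - cobd (F c) t by rewrite nE.
  by rewrite !z expr0 expr1 !nEs; ring.
by rewrite evDl evDl evNl E1 E2 subrr addr0.
Qed.

(** The cochain k with values in the centre of G / (D~, G) has as coboundary a
    combination of cup products, which vanish on C, so k d = 0. *)
Lemma bounding_null_commDtilde (d : G) : bounding d 0 -> d \in N.
Proof.
move=> d0; have vd c := bounding_kron d0 c; have [C [bC evC]] := d0.
pose k s : zcenter (gquot N) := central (\pi_(gquot N) (sc s)).
pose cst i j := structure_constant (fun i => \pi_(gquot N) (h i)) coordM coord_central i j.
pose S c := \sum_i \sum_j cst i j *~
    ev (cupc (class_cochain (al i)) (class_cochain (al j)) : cochain R X 2) c.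
have SB c c' : S (c - c') = S c - S c'.
  rewrite /S -sumrB; apply: eq_bigr => i _; rewrite -sumrB; apply: eq_bigr => j _.
  by rewrite raddfB mulrzBr.
have kC c : zlift k (bnd c) = - S c.
  elim/chain_ind: c => [|c c' cE cE'|s].
  - by rewrite !raddf0 -[X in S X](subrr 0) SB subrr oppr0.
  - by rewrite !raddfB /= cE cE' SB opprB opprK addrC.
  - rewrite bnd2 raddfD raddfB /= !zlift_gen.
    have -> : k (face 1 s) = k (face 2 s) + k (face 0 s) + S << s >>.
      rewrite /k sing_class_simplex gmulfM central_part_mul; congr (_ + _).
      apply: eq_bigr => i _; apply: eq_bigr => j _; rewrite !coord_pi ev_gen.
      by rewrite /cupc frontE backE.
    rewrite !opprD [LHS](AC (1*3*1) ((1*3)*(2*5)*4)) /= subrr addNr add0r.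
    by rewrite add0r.
have := kC C; rewrite bC zlift_gen /S big1 => [|i _]; last first.
  rewrite big1 // => j _; rewrite (class_cochain_cup _ _ vd bC) evC.
  by rewrite -[val 0 _ _]/0 oppr0 mulr0z.
rewrite oppr0 /k sing_class_loop => /(congr1 val).
rewrite central_part_id => [|i]; last by rewrite coord_pi vd.
by move/eqP; rewrite pi_gquot1.
Qed.
End Injectivity.

(** * Surjectivity *)

Lemma additive_lincomb (M N : zmodType) (f : M -> N) r (x : 'I_r -> M)
    (c : 'I_r -> int) : (forall x y, f (x + y) = f x + f y) ->
  f (\sum_i x i *~ c i) = \sum_i f (x i) *~ c i.
Proof.
move=> fD.
have fB : zmod_morphism f.
  by move=> y z; apply: (@addIr _ (f z)); rewrite -fD !subrK.
pose fA : {additive M -> N} := HB.pack f (GRing.isZmodMorphism.Build M N f fB).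
by rewrite -[f]/(fA : M -> N) raddf_sum; apply: eq_bigr => i _; rewrite raddfMz.
Qed.

Lemma skew_sum r (B T : 'I_r -> 'I_r -> int) : (forall i j, B i j = - B j i) ->
  \sum_i \sum_j B i j * T i j =
  \sum_(i < r) \sum_(j < r) (if (i < j)%N then B i j * (T i j - T j i) else 0).
Proof.
move=> Bskew.
pose U (i j : 'I_r) : int := if (i < j)%N then B i j * T i j else 0.
pose V (i j : 'I_r) : int := if (i < j)%N then B i j * T j i else 0.
have -> : \sum_(i < r) \sum_(j < r) (if (i < j)%N then B i j * (T i j - T j i) else 0) =
    \sum_i \sum_j U i j - \sum_i \sum_j V i j.
  rewrite -sumrB; apply: eq_bigr => i _; rewrite -sumrB; apply: eq_bigr => j _.
  by rewrite /U /V; case: ifP => _; rewrite ?subr0 ?mulrBr.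
rewrite [X in _ - X]exchange_big -sumrB; apply: eq_bigr => i _.
rewrite -sumrB; apply: eq_bigr => j _; rewrite /U /V.
have := Bskew i j; case: ltngtP => [ij|ij|/val_inj ->] E.
- by rewrite subr0.
- by rewrite sub0r E mulNr.
- have -> : B j j = 0 by lia.
  by rewrite mul0r subrr.
Qed.

Section Surjectivity.
Variables (R : realType) (X : topologicalType) (x0 : X).
Variable gamma : forall x : X, {path I01 R from x0 to x}.
Local Notation G := (pi1 R x0).
Local Notation Hc := (cohomology R X 1).
Local Notation v a g := (kron (hurewicz (g : G)) a).
Variables (r : nat) (h : 'I_r -> G) (al : 'I_r -> Hc).
Hypothesis alh : forall i j, v (al i) (h j) = (i == j)%:R.
Hypothesis al_torsion : forall x : homology R X 1,
  (forall i, kron x (al i) = 0) -> exists2 n, (0 < n)%N & x *+ n = 0.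

(** The class x minus its expansion on the basis is torsion, so a vanishes on it. *)
Lemma kron_expand (x : homology R X 1) a :
  kron x a = \sum_i v a (h i) * kron x (al i).
Proof.
pose y := \sum_i hurewicz (h i) *~ kron x (al i).
have kD b : forall x y : homology R X 1, kron (x + y) b = kron x b + kron y b.
  by move=> ? ?; exact: kronDl.
have yE b : kron y b = \sum_i v b (h i) * kron x (al i).
  rewrite (additive_lincomb (f := fun x => kron x b)) //.
  by apply: eq_bigr => i _; rewrite mulrzz.
have [n n0 xyn] : exists2 n, (0 < n)%N & (x - y) *+ n = 0.
  apply: al_torsion => i; apply: (@addIr _ (kron y (al i))).
  rewrite -kD subrK add0r yE (bigD1 i) //= big1 ?addr0 => [|j ji].
    by rewrite alh eqxx mul1r.
  by rewrite alh eq_sym (negbTE ji) mul0r.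
have xy0 : kron (x - y) a = 0.
  have k0 : kron (0 : homology R X 1) a = 0.
    by apply: (@addIr _ (kron (0 : homology R X 1) a)); rewrite -kD !add0r.
  have kM m (z : homology R X 1) : kron (z *+ m) a = kron z a *+ m.
    by elim: m => [|m IH]; rewrite ?mulr0n // !mulrS kD IH.
  have := kM n (x - y); rewrite xyn k0 => /esym/eqP.
  by rewrite Num.Theory.mulrn_eq0 -leqn0 leqNgt n0 => /eqP.
by rewrite -yE -[in LHS](subrK y x) kD xy0 add0r.
Qed.

Lemma cohomology_expand (a : Hc) : a = \sum_i al i *~ v a (h i).
Proof.
apply/eqP; rewrite -subr_eq0; apply/eqP; apply: (cohomology_eq0 gamma) => g.
set s := \sum_i _.
apply: (@addIr _ (v s g)); rewrite -kronDr subrK add0r /s.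
rewrite (additive_lincomb (f := fun a => v a g)); last by move=> ? ?; exact: kronDr.
by rewrite kron_expand; apply: eq_bigr => i _; rewrite mulrzz mulrC.
Qed.

Lemma wedge_bounding (x y : homology R X 1) :
  exists d : G, d \in derived G /\ bounding d (wedge_form x y).
Proof.
have [g <-] := hurewicz_surj gamma x; have [k <-] := hurewicz_surj gamma y.
exists (g * k * g^-1 * k^-1)%g; split; last exact: bounding_commutator.
by apply: generated_ge; exists g, k.
Qed.

(** B is the sum over i < j of B (al i) (al j) times the wedge of h i and h j. *)
Lemma alt2_bounding (B : alt2 Hc) :
  exists d : G, d \in derived G /\ bounding d B.
Proof.
have /asboolP[BDl BDr Bskew] := valP B.
pose b i j := val B (al i) (al j).
pose W (i j : 'I_r) : alt2 Hc := if (i < j)%N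
  then wedge_form (hurewicz (h i) *~ b i j) (hurewicz (h j)) else 0.
have -> : B = \sum_i \sum_j W i j.
  apply: val_inj; apply/funext => x; apply/funext => y.
  pose ev2 (C : alt2 Hc) := val C x y.
  have ev2D : {morph ev2 : C D / C + D} by [].
  have ev20 : ev2 0 = 0 by [].
  rewrite -[RHS]/(ev2 _) (big_morph ev2 ev2D ev20).
  under [RHS]eq_bigr do rewrite (big_morph ev2 ev2D ev20).
  have -> : val B x y = \sum_i \sum_j b i j * (v x (h i) * v y (h j)).
    rewrite [in LHS](cohomology_expand x).
    rewrite (additive_lincomb (f := fun x => val B x y)); last by move=> *; exact: BDl.
    apply: eq_bigr => i _; rewrite [in LHS](cohomology_expand y).
    rewrite (additive_lincomb (f := fun y => val B (al i) y)); last by move=> *; exact: BDr.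
    rewrite mulrz_suml; apply: eq_bigr => j _.
    by rewrite -/(b i j) !mulrzz; ring.
  rewrite (skew_sum (fun i j => v x (h i) * v y (h j))); last by move=> i j; exact: Bskew.
  apply: eq_bigr => i _; apply: eq_bigr => j _; rewrite /ev2 /W.
  case: ifP => // _ /=.
  have kz (z : homology R X 1) n c : kron (z *~ n) c = kron z c * n.
    have := additive_lincomb (fun _ : 'I_1 => z) (fun=> n) (fun x y => kronDl x y c).
    by rewrite !big_ord_recl !big_ord0 !addr0 mulrzz.
  by rewrite !kz; ring.
pose K (C : alt2 Hc) := exists d : G, d \in derived G /\ bounding d C.
have K0 : K 0 by exists 1%g; split; [exact: gpred1|exact: bounding1].
have KD C D : K C -> K D -> K (C + D).
  move=> [d [dD dC]] [e [eD eDD]].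
  by exists (d * e)%g; split; [exact: gpredM|exact: boundingM].
rewrite -/(K _); apply: (big_ind K) => // i _; apply: (big_ind K) => // j _.
by rewrite /W; case: ifP => _; first exact: wedge_bounding.
Qed.
End Surjectivity.

Lemma homology_dual_basis (R : realType) (X : topologicalType) (x0 : X)
    (gamma : forall x : X, {path I01 R from x0 to x}) :
  finitely_generated (homology R X 1) ->
  exists r (h : 'I_r -> pi1 R x0) (al : 'I_r -> cohomology R X 1),
    (forall i j, kron (hurewicz (h j)) (al i) = (i == j)%:R) /\
    forall x : homology R X 1, (forall i, kron x (al i) = 0) ->
      exists2 n, (0 < n)%N & x *+ n = 0.
Proof.
move=> [s s_gen].
have [|r [hh [u [uD uh ut]]]] := @dual_system (homology R X 1) (size s) (fun i => s`_i).
  move=> x; have [c ->] := s_gen x; exists (\row_i c i).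
  by apply: eq_bigr => i _; rewrite mxE.
pose al i := projT1 (cid (cohomology_of_hom gamma (uD i))).
have alE i x : kron x (al i) = u i x by rewrite /al; case: cid.
pose h i := projT1 (cid (hurewicz_surj gamma (hh i))).
have hE i : hurewicz (h i) = hh i by rewrite /h; case: cid.
exists r, h, al; split=> [i j|x xa]; first by rewrite alE hE uh.
by apply: ut => i; rewrite -alE.
Qed.

(** * The isomorphism *)

Theorem proposition1 (R : realType) (X : topologicalType) (x0 : X)
    (X_connected : connected [set: X])
    (X_CW : exists Y : topologicalType, is_CW R Y /\ homotopy_equivalent R X Y)
    (H1_fg : finitely_generated (homology R X 1)) :
  let G : groupType := pi1 R x0 in
  let D := derived G in
  exists! phi : subquot D (commDtilde G) -> coker_mu R X,
    [/\ bijective phi,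
        forall x y, phi (x * y)%g = phi x + phi y &
        forall (a b : G) (d : subg_of D),
          val d = (a * b * a^-1 * b^-1)%g ->
          phi (\pi_(subquot D (commDtilde G)) d) =
            coker_mu_class (wedge_form (hurewicz a) (hurewicz b))].
Proof.
move=> G D.
have [gamma] : inhabited (forall x : X, {path I01 R from x0 to x}).
  have J x : exists p : {path I01 R from x0 to x}, True.
    by have [p] := homotopy_CW_joined X_connected X_CW x0 x; exists p.
  by split=> x; exact: projT1 (cid (J x)).
have [r [h [al [alh al_tors]]]] := homology_dual_basis gamma H1_fg.
pose N := commDtilde G.
(* The value 0 is a default: every element of D bounds. *)
pose psi (d : G) : coker_mu R X :=
  if pselect (exists B, bounding d B) is left e
  then coker_mu_class (projT1 (cid e)) else 0.
have psiE d B : bounding d B -> psi d = coker_mu_class B.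
  move=> dB; rewrite /psi; case: pselect => [e|[]]; last by exists B.
  by case: cid => B' dB' /=; exact: bounding_unique dB.
pose phi (x : subquot D N) := psi (val (repr x)).
have phi_pi (d : subg_of D) B : bounding (val d) B ->
    phi (\pi_(subquot D N) d) = coker_mu_class B.
  move=> dB; rewrite /phi; set e := repr _.
  have : (d^-1 * e)%g \in subg_pred N by apply/gequivP; rewrite reprK.
  rewrite unfold_in valM gmulfV => /commDtilde_null e0.
  apply: psiE; rewrite -[val e](mulVKg (val d)) -[B]addr0.
  exact: boundingM.
have bnd_of (d : subg_of D) : exists B, bounding (val d) B.
  by apply: derived_bounding; exact: valP.
have phiM x y : phi (x * y)%g = phi x + phi y.
  rewrite -[x]reprK -[y]reprK -pi_gquotM.
  have [B xB] := bnd_of (repr x); have [B' yB'] := bnd_of (repr y).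
  rewrite (phi_pi _ _ xB) (phi_pi _ _ yB') (phi_pi _ (B + B')).
    by rewrite /coker_mu_class raddfD.
  by rewrite valM; exact: boundingM.
have phi_comm (a b : G) (d : subg_of D) : val d = (a * b * a^-1 * b^-1)%g ->
    phi (\pi_(subquot D N) d) = coker_mu_class (wedge_form (hurewicz a) (hurewicz b)).
  by move=> dE; apply: phi_pi; rewrite dE; exact: bounding_commutator.
have phi_ker x : phi x = 0 -> x = 1%g.
  rewrite -[x]reprK; set d := repr x; have [B dB] := bnd_of d.
  rewrite (phi_pi _ _ dB) => B0.
  apply/eqP; rewrite [_ == _](pi_gquot1 (subg_pred N) d).
  rewrite unfold_in; apply: (bounding_null_commDtilde gamma alh).
    by move=> g /al_tors[n n0 gn]; exact: (hurewicz_torsion gamma n0 gn).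
  have : coker_mu_class B = coker_mu_class 0 by rewrite B0 /coker_mu_class raddf0.
  move=> /coker_mu_eq[s sB]; rewrite subr0 in sB.
  have [C [bC evC]] := dB.
  (* Correcting C by a cycle makes its form vanish. *)
  exists (C + hrep s); split; first by rewrite raddfD /= hrepP addr0.
  move=> a b; rewrite raddfD /= evC -sB.
  rewrite -[X in _ + X](kron_cup (p := 1) (q := 1)).
  exact: addNr.
have phi_inj : injective phi.
  move=> x y xy; apply/eqP; rewrite -divg_eq1; apply/eqP; apply: phi_ker.
  have phiV : phi y^-1%g = - phi y.
    exact: (homV phiM).
  by rewrite phiM phiV xy subrr.
have phi_surj c : exists x, phi x = c.
  rewrite -[c]reprK; set B := repr c.
  have [d [dD dB]] := alt2_bounding gamma alh al_tors B.
  by exists (\pi_(subquot D N) (exist (fun x => x \in D) d dD)); exact: phi_pi.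
exists phi; split.
  split=> //.
  pose psi' c := projT1 (cid (phi_surj c)).
  have K c : phi (psi' c) = c by rewrite /psi'; case: cid.
  by exists psi' => [x|//]; apply: phi_inj; rewrite K.
move=> phi' [_ phiM' phi_comm']; apply/funext => x; rewrite -[x]reprK.
apply: (derived_hom_ext (f := fun d => phi (\pi_(subquot D N) d))
  (f' := fun d => phi' (\pi_(subquot D N) d))) => [d e|d e|a b d dE].
- by rewrite pi_gquotM phiM.
- by rewrite pi_gquotM phiM'.
- by rewrite (phi_comm a b d dE) (phi_comm' a b d dE).
Qed.
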